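(* Let $p$ be a prime and let $n\geq 1$. The theory $\mathrm{Fr}^{n}\text{-}\mathrm{DCF}_p$ eliminates quantifiers in the language $L^{\partial}_{\lambda_0}$.
   Context: All fields have characteristic $p>0$, $n\ge 1$ is an integer, and $q=p^n$. An $\mathrm{Fr}^n$-derivation on a field $K$ is an additive map $\partial\colon K\to K$ with $\partial(xy)=x^{q}\partial(y)+y^{q}\partial(x)$ for all $x,y\in K$; the pair $(K,\partial)$ is called an $\mathrm{Fr}^n$-differential field. $L^\partial$ is the language of fields together with a unary function symbol $\partial$. $\mathrm{Fr}^n\text{-}\mathrm{DF}_p$ is the $L^\partial$-theory of $\mathrm{Fr}^n$-differential fields of characteristic $p$. It is known (Kowalski) that this theory has a model companion in the language $L^\partial$; this model companion is denoted $\mathrm{Fr}^n\text{-}\mathrm{DCF}_p$. $L^\partial_{\lambda_0}$ is $L^\partial$ together with a unary function symbol $\lambda_0$, interpreted in a field $K$ of characteristic $p$ as the function which is the inverse of the Frobenius map on $K^p$ (i.e. $\lambda_0(x^p)=x$) and is zero on $K\setminus K^p$. The theory $\mathrm{Fr}^n\text{-}\mathrm{DCF}_p$ is considered in $L^\partial_{\lambda_0}$ by adding this definition of $\lambda_0$. *)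

(* Defs.v *)
From mathcomp Require Import all_boot.

Set Implicit Arguments.
Unset Strict Implicit.
Unset Printing Implicit Defensive.

(* First-order languages without relation symbols other than equality. *)

Record signature := Signature { symb : Type; arity : symb -> nat }.

(* Terms and formulas are well-scoped: [term L k] and [formula L k] have their
   free variables among the k variables 'I_k.  A quantifier binds the variable
   [ord0] of its body; the free variable i then occurs as [lift ord0 i]. *)

Inductive term (L : signature) (k : nat) : Type :=
| Var of 'I_k
| App (f : symb L) of ('I_(arity f) -> term L k).

Inductive formula (L : signature) : nat -> Type :=
| Bot k : formula L k
| Eq k of term L k & term L k : formula L k
| And k of formula L k & formula L k : formula L k
| Or k of formula L k & formula L k : formula L k
| Imp k of formula L k & formula L k : formula L k
| All k of formula L k.+1 : formula L k
| Ex k of formula L k.+1 : formula L k.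

Arguments Var {L k} _.
Arguments App {L k} f _.
Arguments Bot {L k}.

Definition Neg L k (phi : formula L k) : formula L k := Imp phi Bot.
Definition Iff L k (phi psi : formula L k) : formula L k :=
  And (Imp phi psi) (Imp psi phi).

Fixpoint quantifier_free L k (phi : formula L k) : Prop :=
  match phi with
  | Bot _ | Eq _ _ _ => True
  | And _ a b | Or _ a b | Imp _ a b => quantifier_free a /\ quantifier_free b
  | All _ _ | Ex _ _ => False
  end.

Definition sentence (L : signature) : Type := formula L 0.
Definition theory (L : signature) : Type := sentence L -> Prop.

(* Carriers are not required to be inhabited: the languages used below have
   constant symbols, which forces this. *)
Record structure (L : signature) := Structure {
  carrier :> Type;
  interp : forall f : symb L, ('I_(arity f) -> carrier) -> carrier
}.

Definition env_cons (A : Type) (k : nat) (a : A) (e : 'I_k -> A) : 'I_k.+1 -> A :=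
  fun i => if unlift ord0 i is Some j then e j else a.

Definition env0 (A : Type) : 'I_0 -> A :=
  fun i => match notF (ltn_ord i) with end.

Fixpoint eval L (M : structure L) k (e : 'I_k -> M) (t : term L k) : M :=
  match t with
  | Var i => e i
  | App f args => interp (fun i => eval e (args i))
  end.

Fixpoint sat L (M : structure L) k (phi : formula L k) : ('I_k -> M) -> Prop :=
  match phi with
  | Bot _ => fun _ => False
  | Eq _ t u => fun e => eval e t = eval e u
  | And _ a b => fun e => sat a e /\ sat b e
  | Or _ a b => fun e => sat a e \/ sat b e
  | Imp _ a b => fun e => sat a e -> sat b e
  | All _ a => fun e => forall x : M, sat a (env_cons x e)
  | Ex _ a => fun e => exists x : M, sat a (env_cons x e)
  end.

Definition models L (M : structure L) (T : theory L) : Prop :=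
  forall phi, T phi -> sat phi (@env0 M).

Definition embedding L (M N : structure L) (h : M -> N) : Prop :=
  injective h /\
  forall (f : symb L) (a : 'I_(arity f) -> M), h (interp a) = interp (h \o a).

Definition elementary L (M N : structure L) (h : M -> N) : Prop :=
  forall k (phi : formula L k) (e : 'I_k -> M), sat phi e <-> sat phi (h \o e).

Definition model_complete L (T : theory L) : Prop :=
  forall (M N : structure L) (h : M -> N),
    models M T -> models N T -> embedding h -> elementary h.

Definition embeds_in_models L (T T' : theory L) : Prop :=
  forall M : structure L, models M T ->
    exists (N : structure L) (h : M -> N), models N T' /\ embedding h.

Definition model_companion L (T T' : theory L) : Prop :=
  [/\ model_complete T', embeds_in_models T T' & embeds_in_models T' T].

Definition eliminates_quantifiers L (T : theory L) : Prop :=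
  forall k (phi : formula L k), exists psi : formula L k,
    quantifier_free psi /\
    forall M : structure L, models M T ->
      forall e : 'I_k -> M, sat (Iff phi psi) e.

(* Expansion of a language by one unary function symbol, which is [None]. *)

Definition add_unary (L : signature) : signature :=
  {| symb := option (symb L);
     arity := fun f => if f is Some g then arity g else 1 |}.

Fixpoint lift_term L k (t : term L k) : term (add_unary L) k :=
  match t with
  | Var i => Var i
  | App f args =>
      @App (add_unary L) k (Some f) (fun i => lift_term (args i))
  end.

Fixpoint lift_formula L k (phi : formula L k) : formula (add_unary L) k :=
  match phi with
  | Bot _ => Bot
  | Eq _ t u => Eq (lift_term t) (lift_term u)
  | And _ a b => And (lift_formula a) (lift_formula b)
  | Or _ a b => Or (lift_formula a) (lift_formula b)
  | Imp _ a b => Imp (lift_formula a) (lift_formula b)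
  | All _ a => All (lift_formula a)
  | Ex _ a => Ex (lift_formula a)
  end.

(* The language of fields is {0, 1, +, -, *}, with - unary. *)

Inductive field_symb := Zero | One | Add | Opp | Mul.

Definition Lfield : signature :=
  {| symb := field_symb;
     arity := fun f => match f with
                       | Zero | One => 0
                       | Opp => 1
                       | Add | Mul => 2
                       end |}.

Definition Ld : signature := add_unary Lfield.
Definition Ldl : signature := add_unary Ld.

Definition args0 (A : Type) : 'I_0 -> A := @env0 A.
Definition args1 (A : Type) (a : A) : 'I_1 -> A := fun _ => a.
Definition args2 (A : Type) (a b : A) : 'I_2 -> A :=
  fun i => if val i == 0 then a else b.

Section DifferentialTerms.
Variable k : nat.
Implicit Types t u : term Ld k.

Definition tzero : term Ld k := @App Ld k (Some Zero) (@args0 _).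
Definition tone : term Ld k := @App Ld k (Some One) (@args0 _).
Definition tadd t u : term Ld k := @App Ld k (Some Add) (args2 t u).
Definition topp t : term Ld k := @App Ld k (Some Opp) (args1 t).
Definition tmul t u : term Ld k := @App Ld k (Some Mul) (args2 t u).
Definition tder t : term Ld k := @App Ld k None (args1 t).
Definition tnat (m : nat) : term Ld k := iter m (tadd tone) tzero.
Definition texp t (m : nat) : term Ld k := iter m (tmul t) tone.

End DifferentialTerms.

Arguments tzero {k}.
Arguments tone {k}.
Arguments tnat {k} m.

Definition tlambda k (t : term Ldl k) : term Ldl k :=
  @App Ldl k None (args1 t).

Definition x0 L k : term L k.+1 := Var ord0.
Definition x1 L k : term L k.+2 := Var (lift ord0 ord0).
Definition x2 L k : term L k.+3 := Var (lift ord0 (lift ord0 ord0)).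
Arguments x0 {L k}.
Arguments x1 {L k}.
Arguments x2 {L k}.

Inductive FrDF (p n : nat) : theory Ld :=
| FrDF_addA : FrDF p n
    (All (All (All (Eq (tadd x2 (tadd x1 x0)) (tadd (tadd x2 x1) x0)))))
| FrDF_addC : FrDF p n (All (All (Eq (tadd x1 x0) (tadd x0 x1))))
| FrDF_add0 : FrDF p n (All (Eq (tadd tzero x0) x0))
| FrDF_addN : FrDF p n (All (Eq (tadd (topp x0) x0) tzero))
| FrDF_mulA : FrDF p n
    (All (All (All (Eq (tmul x2 (tmul x1 x0)) (tmul (tmul x2 x1) x0)))))
| FrDF_mulC : FrDF p n (All (All (Eq (tmul x1 x0) (tmul x0 x1))))
| FrDF_mul1 : FrDF p n (All (Eq (tmul tone x0) x0))
| FrDF_mulD : FrDF p n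
    (All (All (All (Eq (tmul (tadd x2 x1) x0)
                       (tadd (tmul x2 x0) (tmul x1 x0))))))
| FrDF_neq01 : FrDF p n (Neg (Eq tone tzero))
| FrDF_inv : FrDF p n
    (All (Imp (Neg (Eq x0 tzero)) (Ex (Eq (tmul x0 x1) tone))))
| FrDF_char : FrDF p n (Eq (tnat p) tzero)
| FrDF_derD : FrDF p n
    (All (All (Eq (tder (tadd x1 x0)) (tadd (tder x1) (tder x0)))))
| FrDF_derM : FrDF p n
    (All (All (Eq (tder (tmul x1 x0))
                  (tadd (tmul (texp x1 (p ^ n)) (tder x0))
                        (tmul (texp x0 (p ^ n)) (tder x1)))))).

(* T together with the definition of lambda_0: it sends y^p to y, and every
   element which is not a p-th power to 0. *)
Inductive with_lambda0 (p : nat) (T : theory Ld) : theory Ldl :=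
| with_lambda0_base phi : T phi -> with_lambda0 p T (lift_formula phi)
| with_lambda0_pow : with_lambda0 p T
    (All (Eq (tlambda (lift_term (texp x0 p))) x0))
| with_lambda0_nonpow : with_lambda0 p T
    (All (Imp (Neg (Ex (Eq (lift_term (texp x0 p)) x1)))
              (Eq (tlambda x0) (lift_term tzero)))).

(* Main.v *)
Require Import Defs.
From Stdlib Require List.
From HB Require Import structures.
From mathcomp Require Import all_boot all_algebra.
From mathcomp Require Import boolp classical_sets filter.
From mathcomp Require Import ring.

(** Quantifier elimination is reduced to amalgamation.  If a formula phi is not
    equivalent modulo T to a quantifier-free formula, then for every finite list
    of quantifier-free formulas there are two points of models of T that agree on
    the list while only one of them satisfies phi; an ultraproduct over all lists
    gives models M and N of T with tuples c and d that agree on every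
    quantifier-free formula and still differ on phi
    ([quantifier_elimination_test]).  For the theory at hand this is impossible:
    the reducts of M and N embed into one model of the companion in such a way
    that c and d get the same image ([common_extension]).  The embeddings are
    elementary by model completeness, and they transfer phi as well because
    lambda0 is definable in the smaller language ([definable_sat]).

    The common extension is built from fields.  Put q = p^n.  The values at c and
    at d of the terms of the large language form one ring A that lies in both M
    and N and is closed under the derivation and under lambda0; let F be its
    field of fractions.  In a model of the companion an element with derivative 0
    is a p-th power, since otherwise its p-th root could be adjoined
    ([adjoin_root_of_constant]), against existential closedness
    ([companion_strict]).  Closure under lambda0 hands this property down: in F,
    too, derivative 0 forces a p-th power.

    This makes M separable over F ([frobenius_descent]).  Suppose that
    sum c_k^p v_k = 0 with c in M and v in F, and scale so that some v_k is 1.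
    Since the derivation kills p-th powers, sum c_k^(pq) d(v_k) = 0, where the
    term with v_k = 1 has disappeared.  By induction on the number of terms this
    shorter system has a nonzero solution b in F, and then sum b_k^p v_k has
    derivative 0.  So it is a p-th power in F, which is a relation over F.

    Separability makes the tensor product of M and N over F reduced
    ([tensor_reduced_p]).  The derivations of M and N extend to it, and in a
    reduced ring the complement P of a maximal multiplicative set S avoiding 0 is
    a prime ideal stable under the derivation: each x in P has some s in S with
    x s = 0, and deriving this relation gives s^(q+1) d(x) = 0
    ([reduced_differential_prime]).  The fraction field of the quotient by P is a
    differential field containing M and N over F ([differential_amalgam]); it
    embeds into a model of the companion. *)

Set Implicit Arguments.
Unset Strict Implicit.
Unset Printing Implicit Defensive.
Import GRing.Theory.

(** * Ultraproducts and a test for quantifier elimination *)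

Lemma env_cons_comp (A B : Type) (h : A -> B) k (a : A) (e : 'I_k -> A) :
  h \o env_cons a e = env_cons (h a) (h \o e).
Proof. by apply/funext => i; rewrite /env_cons /=; case: unlift. Qed.

Lemma env0_eq (A : Type) (e e' : 'I_0 -> A) : e = e'.
Proof. by apply/funext => -[]. Qed.

Lemma eval_embedding L (M N : structure L) (h : M -> N) :
  embedding h ->
  forall k (e : 'I_k -> M) (t : term L k), h (eval e t) = eval (h \o e) t.
Proof.
move=> [_ hh] k e; elim=> [//|f a IH] /=.
by rewrite hh; congr interp; apply/funext => i /=; exact: IH.
Qed.

Lemma sat_embedding L (M N : structure L) (h : M -> N) :
  embedding h ->
  forall k (phi : formula L k), quantifier_free phi ->
  forall e : 'I_k -> M, sat phi e <-> sat phi (h \o e).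
Proof.
move=> hh k; elim=> {k} [k|k t u|k a IHa b IHb|k a IHa b IHb|k a IHa b IHb
  |k a _|k a _] //=.
- move=> _ e; rewrite -!(eval_embedding hh); split=> [->//|].
  by apply: hh.1.
- by move=> [/IHa qa /IHb qb] e; rewrite qa qb.
- by move=> [/IHa qa /IHb qb] e; rewrite qa qb.
- by move=> [/IHa qa /IHb qb] e; rewrite qa qb.
Qed.

Lemma embedding_comp L (M N P : structure L) (h : M -> N) (g : N -> P) :
  embedding h -> embedding g -> embedding (g \o h).
Proof.
move=> [hi hh] [gi gh]; split; first exact: inj_comp.
by move=> f a /=; rewrite hh gh.
Qed.

Section Ultraproduct.
Local Open Scope classical_set_scope.
Variables (L : signature) (I : Type) (U : set_system I) (UU : UltraFilter U).
Variable M : I -> structure L.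

Definition ueq (x : forall i, M i) : set (forall i, M i) :=
  [set y | U [set i | x i = y i]].

(** The quotient by equality almost everywhere, as a type of classes: two
    families with the same class are then equal in the ultraproduct. *)
Definition ucarrier := {C : set (forall i, M i) | exists x, C = ueq x}.

Definition uclass (x : forall i, M i) : ucarrier :=
  exist _ (ueq x) (ex_intro _ x erefl).

Definition urepr (c : ucarrier) : forall i, M i := projT1 (cid (svalP c)).

Lemma ureprK c : uclass (urepr c) = c.
Proof.
rewrite /urepr; case: cid => x /=; case: c => C hC /= defC.
exact: eq_exist.
Qed.

Lemma eq_uclass x y : uclass x = uclass y <-> U [set i | x i = y i].
Proof.
split=> [/(congr1 sval)/= exy|Uxy].
  have : ueq y y by rewrite /ueq /=; apply: filterS filterT => i.
  by rewrite -exy.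
apply: eq_exist; apply/seteqP; split=> z; rewrite /ueq /= => Uz.
- by apply: filterS (filterI Uxy Uz) => i /= [xy xz]; rewrite -xy.
- by apply: filterS (filterI Uxy Uz) => i /= [xy yz]; rewrite xy.
Qed.

Lemma urepr_class x : U [set i | urepr (uclass x) i = x i].
Proof. by apply/eq_uclass; rewrite ureprK. Qed.

Definition ultraproduct : structure L :=
  @Structure L ucarrier (fun f a => uclass (fun i => interp (fun j => urepr (a j) i))).

Definition ucoord k (e : 'I_k -> ultraproduct) i : 'I_k -> M i :=
  fun j => urepr (e j) i.

Let ultra0 (A : set I) : U A -> (forall i, ~ A i) -> False.
Proof. by move=> UA A0; have [i /A0] := filter_ex UA. Qed.

Let ultra_forall n (P : 'I_n -> set I) :
  (forall j, U (P j)) -> U [set i | forall j, P j i].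
Proof. exact: filter_forall. Qed.

Lemma eval_ultraproduct k (e : 'I_k -> ultraproduct) (t : term L k) :
  U [set i | urepr (eval e t) i = eval (ucoord e i) t].
Proof.
elim: t => [j|f a IH] /=; first by apply: filterS filterT => i.
have Ua := ultra_forall IH.
have Uf := urepr_class (fun i => interp (fun j => urepr (eval e (a j)) i)).
apply: filterS (filterI Ua Uf) => i [/= ai ->].
by congr interp; apply/funext.
Qed.

Lemma ultra_setC (A : set I) : U (~` A) <-> ~ U A.
Proof.
split=> [UnA UA|nUA]; last by case: (in_ultra_setVsetC A UU).
by apply: (ultra0 (filterI UA UnA)) => i [].
Qed.

Lemma ucoord_cons k (c : ultraproduct) (e : 'I_k -> ultraproduct) i :
  ucoord (env_cons c e) i = env_cons (urepr c i) (ucoord e i).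
Proof. by apply/funext => j; rewrite /ucoord /env_cons; case: unlift. Qed.

Hypothesis inhabited : forall i, M i.

(** Families of witnesses exist even if some factors have no witness: there the
    value is an arbitrary point, which is why the factors must be inhabited. *)
Let choose_point (P : forall i, M i -> Prop) :
  exists x : forall i, M i, forall i y, P i y -> P i (x i).
Proof.
have ex i : exists x, forall y, P i y -> P i x.
  have [[x Px]|nP] := pselect (exists x, P i x); first by exists x.
  by exists (inhabited i) => y Py; case: nP; exists y.
by exists (fun i => projT1 (cid (ex i))) => i; case: cid.
Qed.

(** Los's theorem.  Maximality of the filter gives the cases of disjunction and
    implication; in the cases of the quantifiers a family of witnesses, or of
    counterexamples, is one point of the ultraproduct. *)
Lemma sat_ultraproduct k (phi : formula L k) (e : 'I_k -> ultraproduct) :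
  sat phi e <-> U [set i | sat phi (ucoord e i)].
Proof.
elim: phi e => {k} [k|k t u|k a IHa b IHb|k a IHa b IHb|k a IHa b IHb
  |k a IHa|k a IHa] e /=.
- by split=> // U0; exact: (ultra0 U0 (fun=> id)).
- have Ut := eval_ultraproduct e t; have Uu := eval_ultraproduct e u.
  rewrite -(ureprK (eval e t)) -(ureprK (eval e u)) eq_uclass.
  split=> Utu; apply: filterS (filterI Utu (filterI Ut Uu)) => i /=.
    by move=> [+ [<- <-]].
  by move=> [+ [-> ->]].
- rewrite IHa IHb; split=> [[Ua Ub]|Uab].
    by apply: filterS (filterI Ua Ub) => i.
  by split; apply: filterS Uab => i [].
- rewrite IHa IHb; split=> [[] Ua|Uab].
  + by apply: filterS Ua => i; left.
  + by apply: filterS Ua => i; right.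
  apply: contrapT => /not_orP[/(ultra_setC _).2 Ua /(ultra_setC _).2 Ub].
  by apply: (ultra0 (filterI Uab (filterI Ua Ub))) => i /= [[]? []].
- rewrite IHa IHb; split=> [Uab|Uab Ua].
    have [/Uab Ub|/(ultra_setC _).2 Ua] := pselect (U [set i | sat a (ucoord e i)]).
      by apply: filterS Ub => i /= sb _.
    by apply: filterS Ua => i /= nsa sa.
  by apply: filterS (filterI Uab Ua) => i /= [] /[apply].
- split=> [Ua|Ua c]; last first.
    by apply/IHa; apply: filterS Ua => i /= Ha; rewrite ucoord_cons; exact: Ha.
  have [x xP] := choose_point
    (fun i y => ~ sat a (env_cons y (ucoord e i))).
  have := Ua (uclass x); rewrite IHa => {}Ua.
  apply: filterS (filterI Ua (urepr_class x)) => i /= [].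
  rewrite ucoord_cons => + xi y; rewrite xi => sx.
  by apply: contrapT => /xP.
- split=> [[c /IHa Uc]|Ua].
    by apply: filterS Uc => i /=; rewrite ucoord_cons; exists (urepr c i).
  have [x xP] := choose_point (fun i y => sat a (env_cons y (ucoord e i))).
  exists (uclass x); apply/IHa.
  apply: filterS (filterI Ua (urepr_class x)) => i /= [[y /xP sx] xi].
  by rewrite ucoord_cons xi.
Qed.

Lemma sat_ultraproduct_class k (phi : formula L k) (x : forall i, 'I_k -> M i) :
  sat phi (fun j => uclass (fun i => x i j) : ultraproduct) <->
  U [set i | sat phi (x i)].
Proof.
rewrite sat_ultraproduct.
have Ux : U [set i | ucoord (fun j => uclass (fun i => x i j)) i = x i].
  have := ultra_forall (fun j => urepr_class (fun i => x i j)).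
  by apply: filterS => i /= xi; apply/funext.
by split=> Us; apply: filterS (filterI Us Ux) => i /= [+ xi]; rewrite xi.
Qed.

Lemma models_ultraproduct (T : theory L) :
  (forall i, models (M i) T) -> models ultraproduct T.
Proof.
move=> MT phi Tphi; apply/sat_ultraproduct; apply: filterS filterT => i _ /=.
by rewrite (env0_eq (ucoord _ i) (@env0 _)); exact: MT.
Qed.

End Ultraproduct.

Section QuantifierEliminationTest.
Local Open Scope classical_set_scope.
Variables (L : signature) (T : theory L) (k : nat).

Definition qf_agree (S : formula L k -> Prop) (M N : structure L)
    (c : 'I_k -> M) (d : 'I_k -> N) :=
  forall psi, S psi -> quantifier_free psi -> sat psi c <-> sat psi d.

(** Properties of tuples in arbitrary structures.  The induction of
    [determined_by_finite] passes through properties not given by formulas. *)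
Definition point_property := forall M : structure L, ('I_k -> M) -> Prop.

Definition determined_by S (P : point_property) :=
  forall (M N : structure L) c d, models M T -> models N T ->
    @qf_agree S M N c d -> P M c -> P N d.

(** A property that only depends on the truth values of finitely many formulas
    is a Boolean combination of them.  For a list starting with psi, the points
    whose remaining truth values are compatible with psi and P form a property
    determined by the tail of the list, and so do those compatible with the
    negation of psi and P; P is recovered from these two by a case distinction
    on psi. *)
Lemma determined_by_finite (s : seq (formula L k)) (P : point_property) :
  determined_by (fun psi => List.In psi s) P ->
  exists psi, quantifier_free psi /\
    forall M : structure L, models M T -> forall c : 'I_k -> M,
      sat psi c <-> P M c.
Proof.
elim: s P => [|psi s IH] P detP.
  have [[M [c [MT Pc]]]|nP] :=
      pselect (exists (M : structure L) c, models M T /\ P M c).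
    exists (Imp Bot Bot); split=> //= N NT d; split=> // _.
    exact: (detP M N c d).
  exists Bot; split=> // N NT d; split=> // Pd; apply: nP.
  by exists N, d.
have [qpsi|nqpsi] := pselect (quantifier_free psi); last first.
  apply: IH => M N c d MT NT agr; apply: detP => // chi [<- //|]; exact: agr.
pose fiber (b : Prop) : point_property := fun M c =>
  exists (N : structure L) d, models N T /\
    [/\ @qf_agree (fun chi => List.In chi s) M N c d, sat psi d <-> b & P N d].
have fiberP b : exists chi, quantifier_free chi /\
    forall M : structure L, models M T -> forall c : 'I_k -> M,
      sat chi c <-> fiber b M c.
  apply: IH => M N c d MT NT agr [M' [c' [MT' [agr' sb Pc']]]].
  exists M', c'; split=> //; split=> // chi sc qc.
  by rewrite -(agr chi) //; exact: agr'.
have [chi1 [q1 chi1P]] := fiberP True.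
have [chi2 [q2 chi2P]] := fiberP False.
exists (Or (And psi chi1) (And (Neg psi) chi2)); split=> [//|M MT c] /=.
split=> [[[sp /(chi1P M MT)]|[sp /(chi2P M MT)]]|Pc].
- move=> [N [d [NT [agr sd Pd]]]].
  apply: (detP N M d c) => // chi [<- _|sc qc]; first by split=> // _; exact/sd.
  exact: iff_sym (agr chi sc qc).
- move=> [N [d [NT [agr sd Pd]]]].
  apply: (detP N M d c) => // chi [<- _|sc qc]; first by split=> // /sd.
  exact: iff_sym (agr chi sc qc).
have [sp|sp] := pselect (sat psi c).
- by left; split=> //; apply/chi1P => //; exists M, c.
- by right; split=> //; apply/chi2P => //; exists M, c.
Qed.

Record configuration := Configuration {
  cfg_struct : structure L;
  cfg_point : 'I_k -> cfg_struct
}.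

(** By [determined_by_finite], if phi is equivalent to no quantifier-free
    formula, every finite list of formulas leaves phi undetermined; the
    ultraproducts along a filter containing, for each psi, the lists in which
    psi occurs are two models whose chosen points agree on every psi. *)
Lemma quantifier_elimination_test (phi : formula L k) :
  (forall M : structure L, models M T -> exists x : M, True) ->
  determined_by (fun=> True) (fun M c => sat phi c) ->
  exists psi, quantifier_free psi /\
    forall M : structure L, models M T -> forall c : 'I_k -> M,
      sat (Iff phi psi) c.
Proof.
move=> inh detphi; apply: contrapT => noqf.
have bad (s : seq (formula L k)) : exists C : configuration * configuration,
    let: (Configuration M c, Configuration N d) := C in
    [/\ models M T, models N T & @qf_agree (fun chi => List.In chi s) M N c d]
    /\ (sat phi c /\ ~ sat phi d).
  apply: contrapT => nbad; apply: noqf.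
  have [|psi [qpsi psiP]] := @determined_by_finite s (fun M c => sat phi c).
    move=> M N c d MT NT agr sc; apply: contrapT => nsd; apply: nbad.
    by exists (Configuration c, Configuration d).
  by exists psi; split=> // M MT c; split=> /= /(psiP M MT).
have [C CP] := choice bad.
pose cone (s : seq (formula L k)) : set (seq (formula L k)) :=
  [set t | forall chi, List.In chi s -> List.In chi t].
have cone_filter : ProperFilter (filter_from setT cone).
  apply: filter_from_proper; last by move=> s _; exists s.
  apply: filter_from_filter; first by exists [::].
  move=> s t _ _; exists (s ++ t) => // u /= su.
  by split=> chi hchi; apply: su; apply/List.in_app_iff; [left|right].
have [U [UU coneU]] := ultraFilterLemma cone_filter.
pose M s := cfg_struct (C s).1; pose N s := cfg_struct (C s).2.
pose c s : 'I_k -> M s := @cfg_point (C s).1.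
pose d s : 'I_k -> N s := @cfg_point (C s).2.
have {}CP s : [/\ models (M s) T, models (N s) T &
    @qf_agree (fun chi => List.In chi s) (M s) (N s) (c s) (d s)]
    /\ (sat phi (c s) /\ ~ sat phi (d s)).
  by have := CP s; rewrite /M /N /c /d; case: (C s) => -[? ?] [? ?].
have MT s : models (M s) T by case: (CP s) => -[].
have NT s : models (N s) T by case: (CP s) => -[].
pose ptM s := projT1 (cid (inh _ (MT s))).
pose ptN s := projT1 (cid (inh _ (NT s))).
have Utrue (P : seq (formula L k) -> Prop) : (forall s, P s) -> U [set s | P s].
  by move=> HP; apply: filterS filterT => s _; exact: HP.
have sc : sat phi (fun j => uclass U (fun s => c s j) : ultraproduct U M).
  by rewrite (sat_ultraproduct_class UU ptM); apply: Utrue => s; exact: (CP s).2.1.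
have nsd : sat (Neg phi) (fun j => uclass U (fun s => d s j) : ultraproduct U N).
  by rewrite (sat_ultraproduct_class UU ptN); apply: Utrue => s; exact: (CP s).2.2.
apply: nsd; refine (detphi (ultraproduct U M) (ultraproduct U N) _ _ _ _ _ sc).
- exact: (models_ultraproduct UU ptM).
- exact: (models_ultraproduct UU ptN).
move=> psi _ qpsi.
rewrite (sat_ultraproduct_class UU ptM) (sat_ultraproduct_class UU ptN).
have Ucone : U (cone [:: psi]) by apply: coneU; exists [:: psi].
have agree s : cone [:: psi] s -> sat psi (c s) <-> sat psi (d s).
  by move=> /(_ psi (or_introl erefl)) ps; case: (CP s) => -[_ _ agr] _; exact: agr.
by split=> Us; apply: filterS (filterI Us Ucone) => s /= [+ /agree [cd dc]].
Qed.

End QuantifierEliminationTest.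

(** * Definability of the inverse of Frobenius *)

Lemma env_cons0 (A : Type) k (a : A) (e : 'I_k -> A) : env_cons a e ord0 = a.
Proof. by rewrite /env_cons unlift_none. Qed.

Lemma env_consS (A : Type) k (a : A) (e : 'I_k -> A) i :
  env_cons a e (lift ord0 i) = e i.
Proof. by rewrite /env_cons liftK. Qed.

Lemma env_cons_eta (A : Type) k (e : 'I_k.+1 -> A) :
  env_cons (e ord0) (e \o lift ord0) = e.
Proof.
apply/funext => i; case: (unliftP ord0 i) => [j|] ->.
- by rewrite env_consS.
- by rewrite env_cons0.
Qed.

Definition env_cat (A : Type) a k (w : 'I_a -> A) (e : 'I_k -> A) :
  'I_(a + k) -> A :=
  fun i => match split i with inl j => w j | inr j => e j end.

Lemma env_catl (A : Type) a k (w : 'I_a -> A) (e : 'I_k -> A) j :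
  env_cat w e (lshift k j) = w j.
Proof. by rewrite /env_cat -[lshift k j]/(unsplit (inl j)) unsplitK. Qed.

Lemma env_catr (A : Type) a k (w : 'I_a -> A) (e : 'I_k -> A) j :
  env_cat w e (rshift a j) = e j.
Proof. by rewrite /env_cat -[rshift a j]/(unsplit (inr j)) unsplitK. Qed.

Lemma env_cat_cons (A : Type) a k x (w : 'I_a -> A) (e : 'I_k -> A) :
  env_cat (env_cons x w) e = env_cons x (env_cat w e).
Proof.
apply/funext => i; rewrite -(splitK i); case: (split i) => j.
  rewrite [unsplit _]/= env_catl; case: (unliftP ord0 j) => [l|] ->.
    have -> : lshift k (lift ord0 l) = lift ord0 (lshift k (l : 'I_a)) :> 'I_(a + k).+1.
      exact/val_inj.
    by rewrite !env_consS env_catl.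
  have -> : lshift k (ord0 : 'I_a.+1) = ord0 :> 'I_(a + k).+1 by exact/val_inj.
  by rewrite !env_cons0.
rewrite [unsplit _]/= env_catr.
have -> : rshift a.+1 j = lift ord0 (rshift a j) :> 'I_(a + k).+1 by exact/val_inj.
by rewrite env_consS env_catr.
Qed.

Fixpoint rename_term L k l (s : 'I_k -> 'I_l) (t : term L k) : term L l :=
  match t with
  | Var i => Var (s i)
  | App f a => App f (fun i => rename_term s (a i))
  end.

Definition rename_up k l (s : 'I_k -> 'I_l) : 'I_k.+1 -> 'I_l.+1 :=
  env_cons ord0 (lift ord0 \o s).

Fixpoint rename_formula L k (phi : formula L k) :
    forall l, ('I_k -> 'I_l) -> formula L l :=
  match phi with
  | Bot _ => fun l _ => Bot
  | Eq _ t u => fun l s => Eq (rename_term s t) (rename_term s u)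
  | And _ a b => fun l s => And (rename_formula a s) (rename_formula b s)
  | Or _ a b => fun l s => Or (rename_formula a s) (rename_formula b s)
  | Imp _ a b => fun l s => Imp (rename_formula a s) (rename_formula b s)
  | All _ a => fun l s => All (rename_formula a (rename_up s))
  | Ex _ a => fun l s => Ex (rename_formula a (rename_up s))
  end.

Lemma eval_rename L (M : structure L) k l (s : 'I_k -> 'I_l) e (t : term L k) :
  eval (M := M) e (rename_term s t) = eval (e \o s) t.
Proof.
elim: t => [//|f a IH] /=; congr interp; exact/funext.
Qed.

Lemma env_cons_rename (A : Type) k l (s : 'I_k -> 'I_l) (x : A) e :
  env_cons x e \o rename_up s = env_cons x (e \o s).
Proof.
rewrite /rename_up env_cons_comp env_cons0; congr env_cons.
by apply/funext => i /=; rewrite env_consS.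
Qed.

Lemma sat_rename L (M : structure L) k (phi : formula L k) l
    (s : 'I_k -> 'I_l) e :
  sat (M := M) (rename_formula phi s) e <-> sat phi (e \o s).
Proof.
elim: phi l s e => {k} [k|k t u|k a IHa b IHb|k a IHa b IHb|k a IHa b IHb
  |k a IHa|k a IHa] l s e //=.
- by rewrite !eval_rename.
- by rewrite IHa IHb.
- by rewrite IHa IHb.
- by rewrite IHa IHb.
- by split=> H x; have := H x; rewrite IHa env_cons_rename.
- by split=> -[x]; rewrite ?IHa => H; exists x; move: H;
     rewrite ?IHa env_cons_rename.
Qed.

Definition reduct L (M : structure (add_unary L)) : structure L :=
  @Structure L M (fun f => @interp (add_unary L) M (Some f)).

Lemma eval_lift L (M : structure (add_unary L)) k (e : 'I_k -> M) (t : term L k) :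
  eval e (lift_term t) = eval (M := reduct M) e t.
Proof. by elim: t => [//|f a IH] /=; congr interp; apply/funext. Qed.

Lemma sat_lift L (M : structure (add_unary L)) k (phi : formula L k)
    (e : 'I_k -> M) :
  sat (lift_formula phi) e <-> sat (M := reduct M) phi e.
Proof.
elim: phi e => {k} [k|k t u|k a IHa b IHb|k a IHa b IHb|k a IHa b IHb
  |k a IHa|k a IHa] e //=.
- by rewrite !eval_lift.
- by rewrite IHa IHb.
- by rewrite IHa IHb.
- by rewrite IHa IHb.
- by split=> H x; have := H x; rewrite IHa.
- by split=> -[x]; rewrite ?IHa => H; exists x; rewrite ?IHa.
Qed.

Section Lambda.
Variable p : nat.

Definition power_of (M : structure Ld) (z : M) : M :=
  eval (M := M) (args1 z) (texp (Var ord0) p : term Ld 1).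

Definition lambda_of (M : structure Ldl) (y : M) : M :=
  @interp Ldl M None (args1 y).

Definition zero_of (M : structure Ld) : M := eval (@env0 M) tzero.

Definition lambda_structure (M : structure Ldl) :=
  (forall z : M, lambda_of (power_of (M := reduct M) z) = z) /\
  (forall y : M, (forall z, power_of (M := reduct M) z <> y) ->
     lambda_of y = zero_of (reduct M)).



Lemma eval_texp (M : structure Ld) k (e : 'I_k -> M) t :
  eval e (texp t p) = power_of (eval e t).
Proof.
rewrite /power_of /texp; elim: p => [|m IH] /=.
  by congr interp; apply/funext => -[].
congr interp; apply/funext => i; rewrite /args2; case: ifP => //= _.
Qed.

Lemma eval_tzero (M : structure Ld) k (e : 'I_k -> M) :
  eval e tzero = zero_of M.
Proof. by rewrite /zero_of /=; congr interp; apply/funext => -[]. Qed.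

Lemma lambda_structureP (T : theory Ld) (M : structure Ldl) :
  models M (with_lambda0 p T) -> models (reduct M) T /\ lambda_structure M.
Proof.
move=> MT; split=> [phi Tphi|].
  by rewrite -sat_lift; apply: MT; constructor.
split=> [z|y nz].
  have lz := MT _ (with_lambda0_pow p T) z; simpl in lz.
  rewrite env_cons0 in lz; rewrite -[RHS]lz; congr interp; apply/funext => i.
  by rewrite /args1 eval_lift eval_texp /= env_cons0.
have := MT _ (with_lambda0_nonpow p T) y; cbn [sat Neg] => ly.
rewrite -(eval_tzero (M := reduct M) (env_cons y (env0 M))) -eval_lift -ly.
  by congr interp; apply/funext => i; rewrite /args1 /= env_cons0.
move=> [z]; rewrite eval_lift eval_texp /= => zy.
by case: (nz z); move: zy; rewrite env_consS !env_cons0.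
Qed.

(** Definability in the small language, uniformly over the structures of the
    large one.  Closure properties of this semantic notion take the place of a
    syntactic translation of formulas. *)
Definition definable k (P : forall M : structure Ldl, ('I_k -> M) -> Prop) :=
  exists phi : formula Ld k, forall M, lambda_structure M ->
    forall e, sat (M := reduct M) phi e <-> P M e.

Lemma definable_rename k l (s : 'I_k -> 'I_l) P :
  @definable k P -> definable (fun M e => P M (e \o s)).
Proof.
move=> [phi phiP]; exists (rename_formula phi s) => M LM e.
by rewrite sat_rename phiP.
Qed.

Lemma definable_and k P Q :
  @definable k P -> definable Q -> definable (fun M e => P M e /\ Q M e).
Proof.
move=> [phi phiP] [psi psiP]; exists (And phi psi) => M LM e /=.
by rewrite phiP // psiP.
Qed.

Lemma definable_ex k P :
  @definable k.+1 P -> definable (fun M e => exists x, P M (env_cons x e)).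
Proof.
move=> [phi phiP]; exists (Ex phi) => M LM e /=.
by split=> -[x /(phiP M LM) Px]; exists x.
Qed.

Lemma definable_exn a k P :
  @definable (a + k) P ->
  definable (fun M e => exists w : 'I_a -> M, P M (env_cat w e)).
Proof.
elim: a => [|a IH] in P *.
  move=> /(definable_rename id)[phi phiP]; exists phi => M LM e; rewrite phiP //.
  have cat0 (w : 'I_0 -> M) : env_cat w e = e.
    have r (i : 'I_k) : rshift 0 i = i by exact/val_inj.
    by apply/funext => i; rewrite -{1}(r i) env_catr.
  by split=> [Pe|[w]]; [exists (@env0 _)|]; rewrite cat0.
move=> /definable_ex/IH[phi phiP]; exists phi => M LM e; rewrite phiP //.
split=> [[w [x Pxw]]|[w Pw]].
  by exists (env_cons x w); rewrite env_cat_cons.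
exists (w \o lift ord0), (w ord0).
by rewrite -env_cat_cons env_cons_eta.
Qed.

Lemma definable_forall n k (P : 'I_n -> forall M : structure Ldl, ('I_k -> M) -> Prop) :
  (forall j, definable (P j)) -> definable (fun M e => forall j, P j M e).
Proof.
move=> /choice[phi phiP].
exists (foldr (fun a b => And a b) (Imp Bot Bot) [seq phi j | j <- enum 'I_n]) => M LM e.
have -> : (forall j, P j M e) <-> (forall j, j \in enum 'I_n -> P j M e).
  by split=> H j; [|apply: H; rewrite mem_enum].
elim: (enum 'I_n) => [|j s IH] /=; first by split=> // _ j.
rewrite (phiP j M LM) IH; split=> [[Pj Ps] l|Ps].
  by rewrite inE => /orP[/eqP ->|/Ps].
by split=> [|l ls]; apply: Ps; rewrite inE ?eqxx // ls orbT.
Qed.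

Definition graph_of k (t : term Ldl k) (M : structure Ldl) (e : 'I_k.+1 -> M) :=
  e ord0 = eval (e \o lift ord0) t.

Definition graph_symb (f : symb Ldl) k (M : structure Ldl)
    (e : 'I_(arity f + k.+1) -> M) :=
  e (rshift _ ord0) = interp (fun j => e (lshift _ j)).

(** Only the symbol for lambda0 needs an argument: z is the value at w if and
    only if z^p = w, or w has no p-th root and z = 0. *)
Lemma definable_symb f k : definable (@graph_symb f k).
Proof.
case: f => [f|].
  exists (@Eq Ld _ (Var (rshift _ ord0)) (App f (fun j => Var (lshift _ j)))).
  by move=> M LM e /=.
pose z : 'I_(1 + k.+1) := rshift 1 ord0; pose w : 'I_(1 + k.+1) := lshift k.+1 ord0.
pose root (i : 'I_(1 + k.+1).+1) : formula Ld (1 + k.+1).+1 :=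
  Eq (texp (Var i) p) (Var (lift ord0 w)).
exists (Or (Eq (texp (Var z) p) (Var w))
  (And (Neg (Ex (Eq (texp x0 p) (Var (lift ord0 w))))) (Eq (Var z) tzero))).
move=> M [LM1 LM2] e.
cbn [sat Neg]; rewrite eval_texp (@eval_tzero (reduct M)) /graph_symb /=.
have -> : interp (fun j => e (lshift k.+1 j)) = lambda_of (e w).
  by congr interp; apply/funext => j; rewrite (ord1 j).
split=> [[zw|[nw zw]]|].
- by rewrite -zw LM1.
- rewrite LM2 // => y yw; apply: nw; exists y.
  by rewrite eval_texp /= env_cons0 env_consS.
have [[y yw]|nw] := pselect (exists y, power_of (M := reduct M) y = e w).
  by rewrite -yw LM1 => zy; left; rewrite zy.
move=> zw; right; split; last by rewrite LM2 in zw => // y yw; apply: nw; exists y.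
by move=> [y]; rewrite eval_texp /= env_cons0 env_consS => yw; apply: nw; exists y.
Qed.

(** The graph of a compound term says that there are values for the arguments,
    each in the graph of its term, on which the symbol takes the given value. *)
Lemma definable_graph k (t : term Ldl k) : definable (graph_of t).
Proof.
elim: t => [i|f args IH].
  by exists (Eq (Var ord0) (Var (lift ord0 i))) => M LM e.
pose s j : 'I_k.+1 -> 'I_(arity f + k.+1) :=
  env_cons (lshift _ j) (fun i => rshift _ (lift ord0 i)).
have [phi phiP] := definable_exn (definable_and (@definable_symb f k)
  (definable_forall (fun j => definable_rename (s j) (IH j)))).
exists phi => M LM e; rewrite phiP // /graph_of /graph_symb.
move: (e : 'I_k.+1 -> M) => {}e.
have sE (w : 'I_(arity f) -> M) j : env_cat w e \o s j = env_cons (w j) (e \o lift ord0).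
  rewrite /s env_cons_comp env_catl; congr env_cons.
  by apply/funext => i /=; rewrite env_catr.
have wE (w : 'I_(arity f) -> M) :
    (forall j, (env_cat w e \o s j) ord0 = eval ((env_cat w e \o s j) \o lift ord0) (args j)) <->
    (w = fun j => eval (e \o lift ord0) (args j)).
  have sub j : (env_cons (w j) (e \o lift ord0)) \o lift ord0 = e \o lift ord0.
    by apply/funext => i /=; rewrite env_consS.
  split=> [H|-> j].
    by apply/funext => j; have := H j; rewrite sE sub env_cons0.
  by rewrite sE env_cons0; congr eval; apply/funext => i /=; rewrite env_consS.
split=> [[w [+ /wE ew]]|e0].
  rewrite env_catr {}ew /= => ->; congr interp; apply/funext => j; by rewrite env_catl.
exists (fun j => eval (e \o lift ord0) (args j)); split; last exact/wE.
rewrite env_catr e0 /=; congr interp; apply/funext => j; by rewrite env_catl.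
Qed.

(** An equation between terms holds if the two graphs share a point; the
    connectives and quantifiers carry over. *)
Lemma definable_sat k (phi : formula Ldl k) : definable (fun M e => sat phi e).
Proof.
elim: phi => {k} [k|k t u|k a [fa faP] b [fb fbP]|k a [fa faP] b [fb fbP]
  |k a [fa faP] b [fb fbP]|k a [fa faP]|k a [fa faP]].
- by exists Bot.
- have [phi phiP] := definable_ex (definable_and (definable_graph t) (definable_graph u)).
  exists phi => M LM e; rewrite phiP // /graph_of /=.
  move: (e : 'I_k -> M) => {}e.
  have sub x : env_cons x e \o lift ord0 = e.
    by apply/funext => i /=; rewrite env_consS.
  split=> [[x]|tu]; first by rewrite env_cons0 sub => -[<-].
  by exists (eval e t); rewrite env_cons0 sub.
- by exists (And fa fb) => M LM e /=; rewrite faP // fbP.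
- by exists (Or fa fb) => M LM e /=; rewrite faP // fbP.
- by exists (Imp fa fb) => M LM e /=; rewrite faP // fbP.
- by exists (All fa) => M LM e /=; split=> H x; apply/(faP M LM).
- by exists (Ex fa) => M LM e /=; split=> -[x H]; exists x; apply/(faP M LM).
Qed.

End Lambda.

Local Open Scope ring_scope.

(** * Twisted derivations and separability *)

Definition frobenius_derivation q (R : pzRingType) (d : R -> R) :=
  {morph d : x y / x + y} /\ forall x y, d (x * y) = x ^+ q * d y + y ^+ q * d x.

Section FrobeniusDerivation.
Variables (q : nat) (R : comPzRingType) (d : R -> R).
Hypothesis dP : frobenius_derivation q d.

Lemma fder0 : d 0 = 0.
Proof. by apply: (addrI (d 0)); rewrite -dP.1 !addr0. Qed.

Lemma fderN : {morph d : x / - x}.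
Proof. by move=> x; apply: (addrI (d x)); rewrite -dP.1 !subrr fder0. Qed.

Lemma fderB : {morph d : x y / x - y}.
Proof. by move=> x y; rewrite dP.1 fderN. Qed.

Lemma fder_sum I (r : seq I) (P : pred I) (E : I -> R) :
  d (\sum_(i <- r | P i) E i) = \sum_(i <- r | P i) d (E i).
Proof. exact: (big_morph d dP.1 fder0). Qed.

Lemma fder1 : d 1 = 0.
Proof.
have := dP.2 1 1; rewrite mulr1 expr1n mul1r => /(congr1 (fun x => x - d 1)).
by rewrite subrr addrK.
Qed.

Lemma fderX x m : d (x ^+ m.+1) = (x ^+ (q * m) * d x) *+ m.+1.
Proof.
elim: m => [|m IH]; first by rewrite muln0 mul1r expr1.
rewrite exprS dP.2 IH mulrnAr mulrA -exprD -mulnS -exprM [(m.+1 * q)%N]mulnC.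
by rewrite [RHS]mulrSr.
Qed.

Lemma fder_pow p x : p%:R = 0 :> R -> (0 < p)%N -> d (x ^+ p) = 0.
Proof.
by case: p => // p p0 _; rewrite fderX -mulr_natl p0 mul0r.
Qed.

End FrobeniusDerivation.

Lemma pchar_powD (R : comNzRingType) p k : p \in [pchar R] ->
  {morph (fun x : R => x ^+ (p ^ k)) : x y / x + y}.
Proof.
move=> charR x y; apply: exprDn_pchar; rewrite pnatX; apply/orP; left.
by rewrite (eq_pnat _ (pcharf_eq charR)) pnat_id // (pcharf_prime charR).
Qed.

Lemma pchar_expN (R : comNzRingType) p (x : R) : p \in [pchar R] ->
  (- x) ^+ p = - x ^+ p.
Proof.
move=> charR; apply: exprNn_pchar.
by rewrite (eq_pnat _ (pcharf_eq charR)) pnat_id // (pcharf_prime charR).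
Qed.

Lemma pchar_pow_sum (R : comNzRingType) p k (I : Type) (r : seq I) P (E : I -> R) :
  p \in [pchar R] ->
  (\sum_(x <- r | P x) E x) ^+ (p ^ k) = \sum_(x <- r | P x) E x ^+ (p ^ k).
Proof.
move=> charR; apply: (big_morph _ (pchar_powD k charR)).
by rewrite expr0n expn_eq0 -leqn0 leqNgt prime_gt0 // (pcharf_prime charR).
Qed.

Section Separability.
Variables (p n : nat) (F M : fieldType) (i : {rmorphism F -> M}).
Hypothesis charF : p \in [pchar F].
Let charM : p \in [pchar M]. Proof. by rewrite (fmorph_pchar i). Qed.
Variables (dF : F -> F) (dM : M -> M).
Hypothesis dFP : frobenius_derivation (p ^ n) dF.
Hypothesis dMP : frobenius_derivation (p ^ n) dM.
Hypothesis i_der : forall x, i (dF x) = dM (i x).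
Hypothesis strict : forall x, dF x = 0 -> exists y, x = y ^+ p.

Variable m : nat.
Implicit Types (c : 'I_m -> M) (f : {ffun 'I_m -> F}) (S : {set 'I_m}).

Definition pairing c (f : 'I_m -> F) := \sum_k c k * i (f k).

Definition supported (A : nmodType) S (f : 'I_m -> A) := forall k, k \notin S -> f k = 0.

(** Subspaces of M^m cut out by linear equations with coefficients in F.  The
    equations involve coordinates in S only, because the size of S is what
    decreases in [frobenius_system_closed]. *)
Definition linear_system S (V : ('I_m -> M) -> Prop) :=
  exists s : seq {ffun 'I_m -> F}, (forall f, f \in s -> supported S f) /\
    forall c, V c <-> forall f, f \in s -> pairing c f = 0.

Lemma linear_system_ext S V W :
  (forall c, V c <-> W c) -> linear_system S V -> linear_system S W.
Proof.
by move=> VW [s [ss sV]]; exists s; split=> // c; rewrite -VW.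
Qed.

Lemma linear_system_sub S (T : {set 'I_m}) V : S \subset T -> linear_system S V -> linear_system T V.
Proof.
move=> ST [s [ss sV]]; exists s; split=> // f /ss Sf k kT; apply: Sf.
by apply: contra kT; exact: (fintype.subsetP ST).
Qed.

Lemma linear_systemT S : linear_system S (fun=> True).
Proof. by exists [::]. Qed.

Lemma linear_systemI S V W :
  linear_system S V -> linear_system S W ->
  linear_system S (fun c => V c /\ W c).
Proof.
move=> [s [ss sV]] [t [ts tW]]; exists (s ++ t); split=> [f|c].
  by rewrite mem_cat => /orP[/ss|/ts].
rewrite sV tW; split=> [[Hs Ht] f|H]; first by rewrite mem_cat => /orP[/Hs|/Ht].
by split=> f fs; apply: H; rewrite mem_cat fs ?orbT.
Qed.

Lemma linear_system_all S (T : eqType) (s : seq T) (V : T -> ('I_m -> M) -> Prop) :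
  (forall t, t \in s -> linear_system S (V t)) ->
  linear_system S (fun c => forall t, t \in s -> V t c).
Proof.
elim: s => [|t s IH] Vs.
  by apply: linear_system_ext (linear_systemT S) => c; split.
have Vt := Vs t (mem_head _ _).
have Vs' := IH (fun u us => Vs u (mem_behead (s := t :: s) us)).
apply: linear_system_ext (linear_systemI Vt Vs') => c.
split=> [[Vtc Vsc] u|H]; first by rewrite inE => /predU1P[->|/Vsc].
by split=> [|u us]; apply: H; rewrite inE ?eqxx ?us ?orbT.
Qed.

Lemma pairing_delta c k : pairing c [ffun l => (l == k)%:R] = c k.
Proof.
rewrite /pairing (bigD1 k) //= ffunE eqxx rmorph1 mulr1 big1 ?addr0 // => l lk.
by rewrite ffunE (negPf lk) rmorph0 mulr0.
Qed.

Lemma linear_system_coord S : linear_system S (fun c => forall k, k \in S -> c k = 0).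
Proof.
exists [seq [ffun l => (l == k)%:R] | k <- enum S]; split=> [f /mapP[k]|c].
  rewrite mem_enum => kS -> l lS; rewrite ffunE; case: eqP => // lk.
  by rewrite lk kS in lS.
split=> [H f /mapP[k]|H k kS].
  by rewrite mem_enum => kS ->; rewrite pairing_delta H.
by rewrite -(pairing_delta c k) H //; apply/mapP; exists k; rewrite ?mem_enum.
Qed.

(** The rank of a matrix over F does not change over M, so a system over F with a
    nonzero solution in M has a nonzero solution in F. *)
Lemma linear_system_descent S V c :
  linear_system S V -> V c -> (exists k, c k != 0) ->
  exists b : 'I_m -> F, (exists k, b k != 0) /\ V (i \o b).
Proof.
move=> [s [_ sV]] /sV Hc [k ck].
pose A : 'M[F]_(m, size s) := \matrix_(a, b) (nth [ffun=> 0] s b) a.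
pose C : 'rV[M]_m := \row_a c a.
have CA : C *m map_mx i A = 0.
  apply/rowP => b; rewrite !mxE.
  rewrite -[RHS](Hc (nth [ffun=> 0] s b)) ?mem_nth //; apply: eq_bigr => a _.
  by rewrite !mxE.
have [Afree|nfree] := boolP (row_free A).
  have : C == 0.
    rewrite -(mulmx_free_eq0 _ (_ : row_free (map_mx i A))) ?CA //.
    by rewrite row_free_map.
  by move=> /eqP/rowP/(_ k); rewrite !mxE => c0; rewrite c0 eqxx in ck.
pose B := nz_row (kermx A).
have B0 : B != 0 by rewrite nz_row_eq0 kermx_eq0.
have BA : B *m A = 0 by apply/sub_kermxP; exact: nz_row_sub.
move: B B0 BA => B B0 BA.
exists (fun a => B 0 a); split.
  apply: contrapT => nB; case/eqP: B0; apply/rowP => a; rewrite !mxE.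
  by apply/eqP; apply: contrapT => /negP Ba; apply: nB; exists a.
apply/sV => f fs; rewrite /pairing /=.
have := congr1 (fun D : 'rV_ _ => i (D 0 (Ordinal (etrans (index_mem f s) fs)))) BA.
rewrite !mxE rmorph0 rmorph_sum => BA0; rewrite -[RHS]BA0; apply: eq_bigr => a _.
by rewrite !mxE rmorphM /= nth_index.
Qed.

Definition frobenius_system k (f : 'I_m -> F) c :=
  pairing (fun l => c l ^+ (p ^ k)) f = 0.

(** If p-linear equations over F are equivalent to linear systems over F, so
    are p^k-linear ones: rewrite the equation in the p-th powers of the unknowns
    as linear equations in these p-th powers, then each of those again. *)
Lemma frobenius_system_iter S :
  (forall f, supported S f -> linear_system S (frobenius_system 1 f)) ->
  forall k f, supported S f -> linear_system S (frobenius_system k f).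
Proof.
move=> one; elim=> [|k IH] f Sf.
  exists [:: f]; split=> [g|c]; first by rewrite inE => /eqP ->.
  rewrite /frobenius_system (_ : (fun l => _) = c); last first.
    by apply/funext => l; rewrite expn0 expr1.
  by split=> [c0 g|]; [rewrite inE => /eqP -> | apply; rewrite mem_head].
have [s [ss sV]] := IH f Sf.
apply: (linear_system_ext _ (linear_system_all (fun g gs => one g (ss g gs)))) => c.
rewrite /frobenius_system (_ : (fun l => c l ^+ (p ^ k.+1)) = (fun l => (c l ^+ p) ^+ (p ^ k))).
  by rewrite expn1 -sV.
by apply/funext => l; rewrite -exprM expnS.
Qed.

Let p_gt0 : (0 < p)%N. Proof. exact: prime_gt0 (pcharf_prime charF). Qed.

(** Separability of M over F in the form: the equation sum c_k^p v_k = 0 amounts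
    to linear equations over F.  If v satisfies a relation sum b_k^p v_k = 0 over
    F, one v_l is eliminated and the support of v shrinks.  Otherwise the claim is
    that c must vanish on the support of v.  If c_k does not, divide the equation
    by v_k and derive it: the coefficients w = d(v/v_k) have a smaller support, so
    by induction the equation sum c_l^(p^(n+1)) w_l = 0 is linear over F and has a
    nonzero solution b in F.  Then sum b_l^p v_l/v_k has derivative 0 and is a
    p-th power g^p, which is a relation over F after all. *)
Lemma frobenius_system_closed s S : (#|S| <= s)%N ->
  forall f, supported S f -> linear_system S (frobenius_system 1 f).
Proof.
elim: s => [|s IH] in S *.
  rewrite leqn0 cards_eq0 => /eqP -> f f0.
  apply: linear_system_ext (linear_systemT _) => c; split=> // _.
  by apply: big1 => l _; rewrite f0 ?inE // rmorph0 mulr0.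
move=> Ss v Sv.
have [[b [l [lS [bl vl bv]]]]|indep] := pselect (exists b : 'I_m -> F,
    exists l, l \in S /\ [/\ b l != 0, v l != 0 & \sum_k b k ^+ p * v k = 0]).
  have cardS' : (#|S :\ l| <= s)%N.
    by move: Ss; rewrite (cardsD1 l) lS add1n ltnS.
  pose e k := - (b k / b l).
  pose v' : {ffun 'I_m -> F} := [ffun k => if k == l then 0 else v k].
  have Sv' : supported (S :\ l) v'.
    move=> k; rewrite ffunE !inE; case: eqP => //= _; exact: Sv.
  have [t [ts tV]] := IH _ cardS' v' Sv'.
  pose extend (f : {ffun 'I_m -> F}) : {ffun 'I_m -> F} :=
    [ffun k => if k == l then \sum_(k | k != l) e k * f k else f k].
  (* the relation b solved for v_l *)
  have vl_eq : v l = \sum_(k | k != l) e k ^+ p * v k.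
    have := congr1 (fun z => z / b l ^+ p) bv; rewrite mul0r (bigD1 l) //= mulrDl.
    rewrite mulrAC mulfV ?expf_eq0 ?(negPf bl) ?andbF // mul1r.
    move=> /eqP; rewrite addr_eq0 => /eqP ->; rewrite mulr_suml -sumrN.
    apply: eq_bigr => k _.
    by rewrite /e (pchar_expN _ charF) exprMn exprVn mulrAC mulNr.
  have extE c f : f l = 0 -> pairing c (extend f) = pairing (fun k => c k + i (e k) * c l) f.
    move=> fl; rewrite /pairing (bigD1 l) //= [RHS](bigD1 l) //= fl rmorph0 mulr0 add0r.
    rewrite ffunE eqxx rmorph_sum mulr_sumr -big_split /=; apply: eq_bigr => k kl.
    rewrite ffunE (negPf kl) rmorphM /=; ring.
  exists [seq extend f | f <- t]; split.
    move=> _ /mapP[f /ts Sf ->] k kS; rewrite ffunE; case: eqP => [kl|_].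
      by rewrite kl lS in kS.
    by apply: Sf; rewrite !inE (negPf kS) andbF.
  move=> c.
  have -> : (forall f, f \in [seq extend f | f <- t] -> pairing c f = 0) <->
      (forall f, f \in t -> pairing (fun k => c k + i (e k) * c l) f = 0).
    split=> [H f ft|H _ /mapP[f ft ->]].
      by rewrite -extE ?(ts f ft) ?H ?map_f // !inE eqxx.
    by rewrite extE ?(ts f ft) ?H // !inE eqxx.
  rewrite -tV /frobenius_system (_ : pairing _ v = pairing
    (fun k => (c k + i (e k) * c l) ^+ (p ^ 1)) v') //.
  rewrite /pairing (bigD1 l) //= [RHS](bigD1 l) //= ffunE eqxx rmorph0 mulr0 add0r.
  rewrite vl_eq rmorph_sum mulr_sumr -big_split /=; apply: eq_bigr => k kl.
  rewrite ffunE (negPf kl) (pchar_powD 1 charM) expn1 exprMn rmorphM rmorphXn /=; ring.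
apply: linear_system_ext (linear_system_sub (_ : [set k in S | v k != 0] \subset S)
  (linear_system_coord _)); last by apply/fintype.subsetP => k; rewrite inE => /andP[].
move=> c; split=> [c0|cV k].
  apply: big1 => k _; have [kS|kS] := boolP (k \in S); last first.
    by rewrite Sv // rmorph0 mulr0.
  have [->|vk] := eqVneq (v k) 0; first by rewrite rmorph0 mulr0.
  by rewrite c0 ?inE ?kS // expr0n expn_eq0 -leqn0 leqNgt p_gt0 mul0r.
rewrite inE => /andP[kS vk]; apply/eqP; apply: contrapT => /negP ck.
apply: indep.
pose S' := [set l in S | (l != k) && (v l != 0)].
have cardS' : (#|S'| <= s)%N.
  apply: (@leq_trans #|S :\ k|).
    by apply: subset_leq_card; apply/fintype.subsetP => l; rewrite !inE => /and3P[-> ->].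
  by move: Ss; rewrite (cardsD1 k) kS add1n ltnS.
pose e l := v l / v k.
pose w : {ffun 'I_m -> F} := [ffun l => dF (e l)].
have Sw : supported S' w.
  move=> l; rewrite inE !ffunE /e => /nandP[lS|/nandP[|]].
  - by rewrite Sv // mul0r (fder0 dFP).
  - by rewrite negbK => /eqP ->; rewrite divff // (fder1 dFP).
  - by rewrite negbK => /eqP ->; rewrite mul0r (fder0 dFP).
have relation : \sum_l c l ^+ p * i (e l) = 0.
  have := congr1 (fun z => z / i (v k)) cV; rewrite mul0r mulr_suml expn1 => cV'; rewrite -[RHS]cV'.
  by apply: eq_bigr => l _; rewrite -mulrA /e fmorph_div.
have derived : \sum_l c l ^+ (p ^ n.+1) * i (w l) = 0.
  have := congr1 dM relation; rewrite (fder_sum dMP) (fder0 dMP) => dr; rewrite -[RHS]dr.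
  apply: eq_bigr => l _; rewrite dMP.2 (fder_pow dMP) ?(pcharf0 charM) //.
  by rewrite mulr0 addr0 ffunE i_der -exprM expnS.
(* c is cut off outside S', so that the solution b over F is nonzero on S' *)
pose c' l := if l \in S' then c l else 0.
have [] := linear_system_descent (V := fun c => frobenius_system n.+1 w c /\
    (forall l, l \in ~: S' -> c l = 0)) (S := [set: 'I_m]) (c := c').
- apply: linear_systemI; apply: linear_system_sub (finset.subsetT _) _.
    exact: frobenius_system_iter (IH S' cardS') n.+1 w Sw.
  exact: linear_system_coord.
- split; last by move=> l; rewrite inE /c' => /negPf ->.
  rewrite /frobenius_system /pairing -[RHS]derived; apply: eq_bigr => l _; rewrite /c'.
  by have [//|lS'] := boolP (l \in S'); rewrite (Sw _ lS') rmorph0 !mulr0.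
- apply: contrapT => nc'; case/negP: ck.
  have : c k ^+ p * i (e k) = 0.
    rewrite -[RHS]relation (bigD1 k) //= big1 ?addr0 // => l lk.
    have [lS'|lS'] := boolP (l \in S').
      have -> : c l = 0.
        by apply/eqP; apply: contrapT => /negP cl; apply: nc'; exists l; rewrite /c' lS'.
      by rewrite expr0n -[p == 0]negbK -lt0n p_gt0 mul0r.
    suff -> : e l = 0 by rewrite rmorph0 mulr0.
    rewrite /e; move: lS'; rewrite inE lk /= negb_and negbK => /orP[lS|/eqP ->].
      by rewrite Sv // mul0r.
    by rewrite mul0r.
  rewrite /e divff // rmorph1 mulr1 => /eqP.
  by rewrite expf_eq0 => /andP[].
move=> b [[l bl] [bsys bS']].
have bF : \sum_l b l ^+ (p ^ n.+1) * w l = 0.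
  apply: (fmorph_inj i); rewrite rmorph0 -[RHS]bsys rmorph_sum.
  by apply: eq_bigr => x _; rewrite rmorphM rmorphXn.
have lS' : l \in S'.
  apply: contrapT => /negP lS'; have := bS' l; rewrite inE lS' => /(_ isT)/eqP.
  by rewrite fmorph_eq0 (negPf bl).
have [g gP] : exists g, \sum_l b l ^+ p * e l = g ^+ p.
  apply: strict; rewrite -[RHS]bF (fder_sum dFP); apply: eq_bigr => x _.
  rewrite dFP.2 (fder_pow dFP) ?(pcharf0 charF) //.
  by rewrite mulr0 addr0 ffunE -exprM expnS.
have [lS lk vl] : [/\ l \in S, l != k & v l != 0] by move: lS'; rewrite inE => /and3P.
have bk : b k = 0.
  have := bS' k; rewrite !inE eqxx andbF => /(_ isT)/eqP.
  by rewrite fmorph_eq0 => /eqP.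
exists (fun x => if x == k then - g else b x), l; split=> //.
rewrite (negPf lk); split=> //.
have := congr1 (fun z => z * v k) gP; rewrite mulr_suml (bigD1 k) //= bk.
rewrite expr0n -[p == 0]negbK -lt0n p_gt0 /= mul0r mul0r add0r => gP'.
rewrite (bigD1 k) //= eqxx.
rewrite (pchar_expN _ charF) mulNr -gP' -sumrN -big_split /= big1 // => x xk.
by rewrite (negPf xk) /e mulrA divfK // addNr.
Qed.

(** Every equation of the system amounts to linear equations over F, by
    [frobenius_system_closed], so a solution in M descends to F. *)
Lemma frobenius_descent (s : seq {ffun 'I_m -> F}) c :
  (forall f, f \in s -> pairing (fun k => c k ^+ p) f = 0) ->
  (exists k, c k != 0) ->
  exists b : 'I_m -> F, (exists k, b k != 0) /\
    forall f, f \in s -> \sum_k b k ^+ p * f k = 0.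
Proof.
move=> cs c0.
have sys : linear_system [set: 'I_m]
    (fun c => forall f, f \in s -> frobenius_system 1 f c).
  apply: linear_system_all => f _.
  by apply: (@frobenius_system_closed #|[set: 'I_m]|) => // k; rewrite inE.
have [|b [b0 bs]] := linear_system_descent sys _ c0.
  by move=> f fs; rewrite /frobenius_system expn1 cs.
exists b; split=> // f fs; apply: (fmorph_inj i); rewrite rmorph0 -[RHS](bs f fs).
by rewrite rmorph_sum; apply: eq_bigr => k _; rewrite expn1 rmorphM rmorphXn.
Qed.

End Separability.

(** * Tensor products of fields *)

Section Functional.
Local Open Scope classical_set_scope.
Variables (F N : fieldType) (j : {rmorphism F -> N}).

(** Linear combinations of points of a graph; the extension theorem works with
    subsets of N * F, as partial linear functions. *)
Inductive span (X : set (N * F)) : N -> F -> Prop :=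
| span0 : span X 0 0
| span_step a y t y' t' : X (y, t) -> span X y' t' ->
    span X (j a * y + y') (a * t + t').

Lemma span_mono X Y y t : X `<=` Y -> span X y t -> span Y y t.
Proof.
move=> XY; elim=> [|a {}y {}t y' t' Xy _ IH]; first exact: span0.
by apply: span_step IH; exact: XY.
Qed.

Lemma span_mem X y t : X (y, t) -> span X y t.
Proof.
move=> Xy; have := span_step 1 Xy (span0 X).
by rewrite rmorph1 !mul1r !addr0.
Qed.

Lemma spanD X y t y' t' : span X y t -> span X y' t' -> span X (y + y') (t + t').
Proof.
move=> + sy'; elim=> [|a {}y {}t y1 t1 Xy _ IH]; first by rewrite !add0r.
by rewrite -!addrA; exact: span_step.
Qed.

Lemma spanZ X c y t : span X y t -> span X (j c * y) (c * t).
Proof.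
elim=> [|a {}y {}t y1 t1 Xy _ IH]; first by rewrite !mulr0; exact: span0.
by rewrite !mulrDr !mulrA -rmorphM; exact: span_step.
Qed.

Variables (m : nat) (v : 'I_m -> N) (f : 'I_m -> F).
Hypothesis fv : forall a : 'I_m -> F, \sum_k j (a k) * v k = 0 -> \sum_k a k * f k = 0.

Let base : set (N * F) := [set u | exists k, u = (v k, f k)].

Let span_base y t : span base y t ->
  exists a : 'I_m -> F, y = \sum_k j (a k) * v k /\ t = \sum_k a k * f k.
Proof.
elim=> [|a {}y {}t y' t' [k [-> ->]] _ [b [-> ->]]].
  by exists (fun=> 0); split; rewrite big1 // => k _; rewrite ?rmorph0 mul0r.
exists (fun l => (if l == k then a else 0) + b l); split.
  rewrite [RHS](eq_bigr (fun l => (if l == k then j a * v l else 0) + j (b l) * v l)).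
    by rewrite big_split -big_mkcond big_pred1_eq.
  by move=> l _; rewrite rmorphD mulrDl; case: eqP; rewrite // rmorph0 mul0r.
rewrite [RHS](eq_bigr (fun l => (if l == k then a * f l else 0) + b l * f l)).
  by rewrite big_split -big_mkcond big_pred1_eq.
by move=> l _; rewrite mulrDl; case: eqP; rewrite // mul0r.
Qed.

Let consistent : set (set (N * F)) :=
  [set X | forall t, span (X `|` base) 0 t -> t = 0].

(** The assignment of f_k to v_k extends to a linear functional on N as soon as
    it respects the linear relations between the v_k.  Take a maximal set of
    pairs that together with the pairs (v_k, f_k) spans no (0, t) with t nonzero;
    a point y outside the domain of its span could be added with value 0. *)
Lemma functional_extension : exists l : N -> F,
  [/\ {morph l : x y / x + y}, forall a x, l (j a * x) = a * l x
    & forall k, l (v k) = f k].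
Proof.
have base0 t : span base 0 t -> t = 0.
  by move=> /span_base[a [/esym /fv]] + ->.
have [C CC Ctot|A [Acons Amax]] := @Zorn_bigcup _ consistent.
  move=> t st.
  have : span base 0 t \/ exists2 X, C X & span (X `|` base) 0 t.
    elim: st => {t} [|a y t y' t' Xy _ [sb|[X CX sX]]]; first by left; exact: span0.
    - case: Xy => [[X CX Xy]|by_]; [right; exists X => //|by left; exact: span_step].
      by apply: span_step; [left|apply: span_mono sb => u; right].
    - right; case: Xy => [[Y CY Yy]|by_]; last by exists X => //; apply: span_step => //; right.
      have [XY|YX] := Ctot _ _ CX CY.
        exists Y => //; apply: span_step; first by left.
        by apply: span_mono sX; exact: setSU.
      by exists X => //; apply: span_step => //; left; exact: YX.
  by move=> [/base0//|[X /CC]]; exact.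
have total y : exists t, span (A `|` base) y t.
  apply: contrapT => ny; apply: (Amax (A `|` [set (y, 0)])).
    split; first exact: subsetUl.
    move=> /(_ (y, 0) (or_intror erefl)) Ay; apply: ny; exists 0.
    by apply: span_mem; left.
  move=> t st.
  have decomp y' t' : span ((A `|` [set (y, 0)]) `|` base) y' t' ->
      exists c, span (A `|` base) (y' - j c * y) t'.
    elim=> {y' t' t st} [|a y1 t1 y' t' Xy _ [c IH]].
      by exists 0; rewrite rmorph0 mul0r subr0; exact: span0.
    case: Xy => [[Ay|[-> ->]]|by_].
    - by exists c; rewrite -addrA; apply: span_step => //; left.
    - exists (c + a); rewrite mulr0 add0r.
      by have -> : j a * y + y' - j (c + a) * y = y' - j c * y by rewrite rmorphD; ring.
    - by exists c; rewrite -addrA; apply: span_step => //; right.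
  have [c] := decomp _ _ st; rewrite sub0r => sc.
  have [c0|c0] := eqVneq c 0.
    by apply: Acons; move: sc; rewrite c0 rmorph0 mul0r oppr0.
  case: ny; exists (- c^-1 * t).
  have := spanZ (- c^-1) sc.
  by rewrite rmorphN mulrNN mulrA -rmorphM mulVf // rmorph1 mul1r.
have functional y t t' : span (A `|` base) y t -> span (A `|` base) y t' -> t = t'.
  move=> st st'; apply/eqP; rewrite -subr_eq0; apply/eqP/Acons.
  have := spanD st (spanZ (- 1) st').
  by rewrite rmorphN rmorph1 !mulN1r subrr.
have [l lP] := choice total; exists l; split.
- by move=> x y; apply: functional (lP _) (spanD (lP x) (lP y)).
- by move=> a x; apply: functional (lP _) (spanZ a (lP x)).
- by move=> k; apply: functional (lP _) (span_mem _); right; exists k.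
Qed.

End Functional.

Section Tensor.
Variables (F M N : fieldType) (i : {rmorphism F -> M}) (j : {rmorphism F -> N}).

Definition balanced (V : zmodType) (b : M -> N -> V) :=
  [/\ forall y, {morph b^~ y : x x' / x + x'}, forall x, {morph b x : y y' / y + y'}
    & forall a x y, b (i a * x) y = b x (j a * y)].

Definition formal_eval (V : zmodType) (b : M -> N -> V) (s : seq (M * N)) : V :=
  \sum_(u <- s) b u.1 u.2.

(** Two formal sums of pure tensors are identified when no balanced biadditive
    map separates them.  The quotient has the universal property of the tensor
    product by construction; in exchange, that a sum is nonzero is shown by
    exhibiting a balanced map. *)
Definition tensor_rel (s t : seq (M * N)) : bool :=
  `[< forall (V : zmodType) (b : M -> N -> V), balanced b ->
      formal_eval b s = formal_eval b t >].

Lemma tensor_rel_refl : reflexive tensor_rel.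
Proof. by move=> s; apply/asboolP. Qed.

Lemma tensor_rel_sym : symmetric tensor_rel.
Proof.
by move=> s t; apply/asboolP/asboolP => st V b bP; rewrite st.
Qed.

Lemma tensor_rel_trans : transitive tensor_rel.
Proof.
move=> t s u /asboolP st /asboolP tu; apply/asboolP => V b bP.
by rewrite st // tu.
Qed.

Canonical tensor_equiv :=
  EquivRel tensor_rel tensor_rel_refl tensor_rel_sym tensor_rel_trans.

Definition tensor := {eq_quot tensor_equiv}%qT.
HB.instance Definition _ := Choice.on tensor.
HB.instance Definition _ := EqQuotient.on tensor.

Definition tensor_lift (V : zmodType) (b : M -> N -> V) (z : tensor) : V :=
  formal_eval b (repr z).

Lemma tensor_lift_pi V b s : @balanced V b ->
  tensor_lift b (\pi_tensor s)%qT = formal_eval b s.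
Proof.
move=> bP; rewrite /tensor_lift; case: piP => t /eqquotP/asboolP ts.
by rewrite ts.
Qed.

Lemma tensor_eqP (z z' : tensor) :
  (forall (V : zmodType) (b : M -> N -> V), balanced b ->
    tensor_lift b z = tensor_lift b z') -> z = z'.
Proof.
move=> zz; rewrite -[z]reprK -[z']reprK; apply/eqquotP/asboolP => V b bP.
exact: zz.
Qed.

Definition pure x y : tensor := (\pi_tensor [:: (x, y)])%qT.
Definition tensor_add (z z' : tensor) : tensor := (\pi_tensor (repr z ++ repr z'))%qT.
Definition tensor_opp (z : tensor) : tensor :=
  (\pi_tensor [seq (- u.1, u.2) | u <- repr z])%qT.

Lemma tensor_lift_pure V b x y : @balanced V b -> tensor_lift b (pure x y) = b x y.
Proof. by move=> bP; rewrite tensor_lift_pi // /formal_eval big_seq1. Qed.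

Lemma tensor_lift_add V b z z' : @balanced V b ->
  tensor_lift b (tensor_add z z') = tensor_lift b z + tensor_lift b z'.
Proof. by move=> bP; rewrite tensor_lift_pi // /formal_eval big_cat. Qed.

Lemma balanced0l V b y : @balanced V b -> b 0 y = 0.
Proof. by move=> [bl _ _]; apply: (addrI (b 0 y)); rewrite -bl !addr0. Qed.

Lemma balanced0r V b x : @balanced V b -> b x 0 = 0.
Proof. by move=> [_ br _]; apply: (addrI (b x 0)); rewrite -br !addr0. Qed.

Lemma balancedNl V b x y : @balanced V b -> b (- x) y = - b x y.
Proof.
move=> bP; apply: (addrI (b x y)); case: (bP) => bl _ _.
by rewrite -bl !subrr (balanced0l _ bP).
Qed.

Lemma tensor_lift_opp V b z : @balanced V b ->
  tensor_lift b (tensor_opp z) = - tensor_lift b z.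
Proof.
move=> bP; rewrite tensor_lift_pi // /formal_eval big_map -sumrN.
by apply: eq_bigr => u _; rewrite (balancedNl _ _ bP).
Qed.

Lemma tensor_lift_0 V b : @balanced V b -> tensor_lift b (pure 0 0) = 0.
Proof. by move=> bP; rewrite tensor_lift_pure // (balanced0l _ bP). Qed.

Lemma tensor_addA : associative tensor_add.
Proof. by move=> x y z; apply: tensor_eqP => V b bP; rewrite !tensor_lift_add // addrA. Qed.
Lemma tensor_addC : commutative tensor_add.
Proof. by move=> x y; apply: tensor_eqP => V b bP; rewrite !tensor_lift_add // addrC. Qed.
Lemma tensor_add0 : left_id (pure 0 0) tensor_add.
Proof.
by move=> x; apply: tensor_eqP => V b bP; rewrite tensor_lift_add // tensor_lift_0 // add0r.
Qed.
Lemma tensor_addN : left_inverse (pure 0 0) tensor_opp tensor_add.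
Proof.
move=> x; apply: tensor_eqP => V b bP.
by rewrite tensor_lift_add // tensor_lift_0 // tensor_lift_opp // addNr.
Qed.

HB.instance Definition _ := GRing.isZmodule.Build tensor
  tensor_addA tensor_addC tensor_add0 tensor_addN.

Lemma tensor_liftD V b : @balanced V b -> {morph tensor_lift b : z z' / z + z'}.
Proof. by move=> bP z z'; exact: tensor_lift_add. Qed.

Lemma pure_balanced : balanced pure.
Proof.
split=> [y x x'|x y y'|a x y]; apply: tensor_eqP => V b bP;
  rewrite ?tensor_liftD // !tensor_lift_pure //; by case: bP => bl br bb; rewrite ?bl ?br ?bb.
Qed.

Lemma tensor_repr (z : tensor) : z = \sum_(u <- repr z) pure u.1 u.2.
Proof.
apply: tensor_eqP => V b bP.
rewrite (big_morph _ (tensor_liftD bP) (tensor_lift_0 bP)) /tensor_lift.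
by apply: eq_bigr => u _; rewrite -[RHS]/(tensor_lift b _) tensor_lift_pure.
Qed.

Lemma tensor_ind (P : tensor -> Prop) :
  P 0 -> (forall z z', P z -> P z' -> P (z + z')) -> (forall x y, P (pure x y)) ->
  forall z, P z.
Proof.
by move=> P0 PD Pp z; rewrite [z]tensor_repr; apply: big_ind => // u _; exact: Pp.
Qed.

Definition act_pure x y : tensor -> tensor :=
  tensor_lift (fun x' y' => pure (x * x') (y * y')).

Lemma act_pure_balanced x y : balanced (fun x' y' => pure (x * x') (y * y')).
Proof.
have [bl br bb] := pure_balanced.
split=> [y' x1 x2|x' y1 y2|a x' y']; first by rewrite mulrDr bl.
- by rewrite mulrDr br.
- by rewrite mulrCA bb mulrCA.
Qed.

Definition tensor_mul (z z' : tensor) : tensor :=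
  tensor_lift (fun x y => act_pure x y z') z.

Lemma tensor_mul_balanced z' : balanced (fun x y => act_pure x y z').
Proof.
have [bl br bb] := pure_balanced.
rewrite /act_pure /tensor_lift /formal_eval; split=> [y x1 x2|x y1 y2|a x y].
- by rewrite -big_split; apply: eq_bigr => u _; rewrite mulrDl bl.
- by rewrite -big_split; apply: eq_bigr => u _; rewrite mulrDl br.
- by apply: eq_bigr => u _; rewrite -mulrA bb mulrA.
Qed.

Lemma tensor_mul_pure x y x' y' : tensor_mul (pure x y) (pure x' y') = pure (x * x') (y * y').
Proof.
rewrite /tensor_mul (tensor_lift_pure _ _ (tensor_mul_balanced _)) /act_pure.
by rewrite (tensor_lift_pure _ _ (act_pure_balanced x y)).
Qed.

Lemma tensor_mulDl : left_distributive tensor_mul +%R.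
Proof. by move=> z1 z2 z; rewrite /tensor_mul (tensor_liftD (tensor_mul_balanced _)). Qed.

Lemma tensor_mulC : commutative tensor_mul.
Proof.
have mulDr z : {morph tensor_mul z : z1 z2 / z1 + z2}.
  move=> z1 z2; rewrite /tensor_mul /tensor_lift /formal_eval -big_split.
  apply: eq_bigr => u _; exact: (tensor_liftD (act_pure_balanced _ _)).
have mul0r_ z : tensor_mul z 0 = 0.
  by apply: (addrI (tensor_mul z 0)); rewrite -mulDr !addr0.
have mul0l z : tensor_mul 0 z = 0.
  by apply: (addrI (tensor_mul 0 z)); rewrite -tensor_mulDl !addr0.
move=> z z'; elim/tensor_ind: z => [|z1 z2 IH1 IH2|x y].
- by rewrite mul0r_ mul0l.
- by rewrite tensor_mulDl mulDr IH1 IH2.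
elim/tensor_ind: z' => [|z1 z2 IH1 IH2|x' y'].
- by rewrite mul0r_ mul0l.
- by rewrite tensor_mulDl mulDr IH1 IH2.
by rewrite !tensor_mul_pure mulrC [y * _]mulrC.
Qed.

Let mul0t z : tensor_mul 0 z = 0.
Proof. by apply: (addrI (tensor_mul 0 z)); rewrite -tensor_mulDl !addr0. Qed.
Let mult0 z : tensor_mul z 0 = 0.
Proof. by rewrite tensor_mulC mul0t. Qed.
Let mulDr z z1 z2 : tensor_mul z (z1 + z2) = tensor_mul z z1 + tensor_mul z z2.
Proof. by rewrite !(tensor_mulC z) tensor_mulDl. Qed.

Lemma tensor_mulA : associative tensor_mul.
Proof.
move=> z1 z2 z3; elim/tensor_ind: z1 => [|z z' IH IH'|x y].
- by rewrite !mul0t.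
- by rewrite !tensor_mulDl IH IH'.
elim/tensor_ind: z2 => [|z z' IH IH'|x2 y2].
- by rewrite mult0 !mul0t mult0.
- by rewrite tensor_mulDl !mulDr tensor_mulDl IH IH'.
elim/tensor_ind: z3 => [|z z' IH IH'|x3 y3].
- by rewrite !mult0.
- by rewrite !mulDr IH IH'.
by rewrite !tensor_mul_pure !mulrA.
Qed.

Lemma tensor_mul1 : left_id (pure 1 1) tensor_mul.
Proof.
move=> z; elim/tensor_ind: z => [|z z' IH IH'|x y].
- by rewrite mult0.
- by rewrite mulDr IH IH'.
by rewrite tensor_mul_pure !mul1r.
Qed.

(** If sum u_k (x) v_k = 0, then u is orthogonal to all f in F^m orthogonal to the
    relations between the v_k: such an f comes from a linear functional l on N
    by [functional_extension], and x l(y) is balanced in x and y. *)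
Lemma tensor_zero_functional m (u : 'I_m -> M) (v : 'I_m -> N) (f : 'I_m -> F) :
  \sum_k pure (u k) (v k) = 0 ->
  (forall a : 'I_m -> F, \sum_k j (a k) * v k = 0 -> \sum_k a k * f k = 0) ->
  \sum_k u k * i (f k) = 0.
Proof.
move=> uv0 fv; have [l [lD lZ lv]] := functional_extension fv.
pose b x y : M := x * i (l y).
have bP : balanced b.
  split=> [y x x'|x y y'|a x y]; rewrite /b; first exact: mulrDl.
    by rewrite lD rmorphD mulrDr.
  by rewrite lZ rmorphM; ring.
have := congr1 (tensor_lift b) uv0; rewrite (tensor_lift_0 bP).
rewrite (big_morph _ (tensor_liftD bP) (tensor_lift_0 bP)) => b0.
rewrite -[RHS]b0; apply: eq_bigr => k _.
by rewrite (tensor_lift_pure _ _ bP) /b lv.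
Qed.

Lemma tensor_one_neq0 : pure 1 1 != 0.
Proof.
apply/eqP => one0.
have := @tensor_zero_functional 1 (fun=> 1) (fun=> 1) (fun=> 1).
rewrite !big_ord1 rmorph1 mulr1 => /(_ one0) H.
have /eqP := oner_neq0 M; apply; apply: H => a.
by rewrite !big_ord1 !mulr1 => /eqP; rewrite fmorph_eq0 => /eqP.
Qed.

HB.instance Definition _ := GRing.Zmodule_isComNzRing.Build tensor
  tensor_mulA tensor_mulC tensor_mul1 tensor_mulDl tensor_one_neq0.

End Tensor.

(** * Residue fields of differential primes *)

Record differential_prime (R : pzRingType) (d : R -> R) (P : R -> Prop) : Prop := {
  dprime0 : P 0;
  dprimeD : forall x y, P x -> P y -> P (x + y);
  dprimeMr : forall x y, P x -> P (x * y);
  dprime1 : ~ P 1;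
  dprime_or : forall x y, P (x * y) -> P x \/ P y;
  dprime_der : forall x, P x -> P (d x)
}.

(** The fraction field of the quotient by P is formed in one step, from pairs of
    a numerator and a denominator outside P. *)
Section ResidueField.
Variables (q : nat) (R : comNzRingType) (d : R -> R) (P : R -> Prop).
Hypothesis q_gt0 : (0 < q)%N.
Hypothesis powD : {morph (fun x : R => x ^+ q) : x y / x + y}.
Hypothesis dP : frobenius_derivation q d.
Hypothesis PP : differential_prime d P.

Let P0 := dprime0 PP.
Let PD := @dprimeD _ _ _ PP.
Let PMr := @dprimeMr _ _ _ PP.
Let PMl x y : P y -> P (x * y). Proof. by rewrite mulrC; exact: PMr. Qed.
Let PN x : P x -> P (- x). Proof. by move=> Px; rewrite -mulN1r; exact: PMl. Qed.
Let notPM x y : ~ P x -> ~ P y -> ~ P (x * y).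
Proof. by move=> nx ny /(dprime_or PP)[]. Qed.
Let notPX x k : ~ P x -> ~ P (x ^+ k).
Proof.
by move=> nx; elim: k => [|k IH]; [exact: dprime1 PP|rewrite exprS; exact: notPM].
Qed.

Definition denominator := {s : R | `[< ~ P s >]}.

Definition fraction_rel (u v : R * denominator) : bool :=
  `[< P (u.1 * sval v.2 - v.1 * sval u.2) >].

Lemma fraction_rel_refl : reflexive fraction_rel.
Proof. by move=> u; apply/asboolP; rewrite subrr. Qed.

Lemma fraction_rel_sym : symmetric fraction_rel.
Proof.
by move=> u v; apply/asboolP/asboolP => /PN; rewrite opprB.
Qed.

Lemma fraction_rel_trans : transitive fraction_rel.
Proof.
move=> [y [t /= ht]] [x [s /= hs]] [z [w /= hw]] /asboolP /= uv /asboolP /= vw.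
apply/asboolP => /=.
have : P (t * (x * w - z * s)).
  have -> : t * (x * w - z * s) = (x * t - y * s) * w + (y * w - z * t) * s by ring.
  by apply: PD; apply: PMr.
by case/(dprime_or PP) => // Pt; move/asboolP: ht.
Qed.

Canonical fraction_equiv :=
  EquivRel fraction_rel fraction_rel_refl fraction_rel_sym fraction_rel_trans.

Definition residue := {eq_quot fraction_equiv}%qT.
HB.instance Definition _ := Choice.on residue.
HB.instance Definition _ := EqQuotient.on residue.

Definition frac x s (ns : ~ P s) : residue :=
  (\pi_residue (x, exist _ s (asboolT ns) : denominator))%qT.

Definition num (k : residue) : R := (repr k).1.
Definition den (k : residue) : R := sval (repr k).2.

Lemma den_notP k : ~ P (den k).
Proof. by apply/asboolP; exact: (svalP (repr k).2). Qed.

Lemma frac_eqP x s y t (ns : ~ P s) (nt : ~ P t) :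
  frac x ns = frac y nt <-> P (x * t - y * s).
Proof.
split=> [/eqquotP/asboolP//|Pxy]; exact/eqquotP/asboolP.
Qed.

Lemma frac_repr k : k = frac (num k) (@den_notP k).
Proof.
rewrite -[LHS]reprK; apply/eqquotP/asboolP => /=.
by rewrite /num /den subrr.
Qed.

Lemma frac_numden x s (ns : ~ P s) : P (num (frac x ns) * s - x * den (frac x ns)).
Proof. by apply/(frac_eqP _ _ (@den_notP _)); rewrite -frac_repr. Qed.

Lemma residue_ind (Q : residue -> Prop) :
  (forall x s (ns : ~ P s), Q (frac x ns)) -> forall k, Q k.
Proof. by move=> HQ k; rewrite [k]frac_repr. Qed.

Definition radd k l := frac (num k * den l + num l * den k) (notPM (@den_notP k) (@den_notP l)).
Definition rmul k l := frac (num k * num l) (notPM (@den_notP k) (@den_notP l)).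
Definition ropp k := frac (- num k) (@den_notP k).
Definition rzero := frac 0 (dprime1 PP).
Definition rone := frac 1 (dprime1 PP).
(** The quotient rule for a derivation twisted by the q-th power. *)
Definition rder k := frac (den k ^+ q * d (num k) - num k ^+ q * d (den k))
  (notPX (k := (q * 2)%N) (@den_notP k)).

Lemma raddE x s y t (ns : ~ P s) (nt : ~ P t) (nst : ~ P (s * t)) :
  radd (frac x ns) (frac y nt) = frac (x * t + y * s) nst.
Proof.
apply/frac_eqP; move: (frac_numden x ns) (frac_numden y nt).
move: (num (frac x ns)) (den (frac x ns)) (num (frac y nt)) (den (frac y nt)).
move=> x' s' y' t' Px Py.
have -> : (x' * t' + y' * s') * (s * t) - (x * t + y * s) * (s' * t') =
  (x' * s - x * s') * (t' * t) + (y' * t - y * t') * (s' * s) by ring.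
by apply: PD; apply: PMr.
Qed.

Lemma rmulE x s y t (ns : ~ P s) (nt : ~ P t) (nst : ~ P (s * t)) :
  rmul (frac x ns) (frac y nt) = frac (x * y) nst.
Proof.
apply/frac_eqP; move: (frac_numden x ns) (frac_numden y nt).
move: (num (frac x ns)) (den (frac x ns)) (num (frac y nt)) (den (frac y nt)).
move=> x' s' y' t' Px Py.
have -> : x' * y' * (s * t) - x * y * (s' * t') =
  (x' * s - x * s') * (y' * t) + (y' * t - y * t') * (x * s') by ring.
by apply: PD; apply: PMr.
Qed.

Lemma roppE x s (ns : ~ P s) : ropp (frac x ns) = frac (- x) ns.
Proof.
apply/frac_eqP; rewrite !mulNr -opprD; apply: PN.
exact: frac_numden.
Qed.

(** Independence of the representative: if y s - x t lies in P, so do its q-th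
    power, which is y^q s^q - x^q t^q, and its derivative, and the difference of
    the two quotients is a combination of these. *)
Lemma rderE x s (ns : ~ P s) (ns2 : ~ P (s ^+ (q * 2))) :
  rder (frac x ns) = frac (s ^+ q * d x - x ^+ q * d s) ns2.
Proof.
apply/frac_eqP; have := frac_numden x ns; have nt := @den_notP (frac x ns).
move: (num _) (den _) nt => y t nt Pxy.
have Pq : P (y ^+ q * s ^+ q - x ^+ q * t ^+ q).
  have e : (y * s) ^+ q = (y * s - x * t) ^+ q + (x * t) ^+ q by rewrite -powD subrK.
  rewrite -!exprMn e addrK -(prednK q_gt0) exprS; exact: PMr.
have := dprime_der PP Pxy; rewrite (fderB dP) !dP.2 !exprM.
move: (y ^+ q) (s ^+ q) (x ^+ q) (t ^+ q) Pq => Y S X T Pq PE.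
set E := (X in P X) in PE.
have -> : (T * d y - Y * d t) * S ^+ 2 - (S * d x - X * d s) * T ^+ 2 =
  E * (S * T) + (Y * S - X * T) * (- (d s) * T - S * d t).
  by rewrite /E; ring.
by apply: PD; apply: PMr.
Qed.

Lemma raddM x s y t (ns : ~ P s) (nt : ~ P t) :
  radd (frac x ns) (frac y nt) = frac (x * t + y * s) (notPM ns nt).
Proof. exact: raddE. Qed.

Lemma rmulM x s y t (ns : ~ P s) (nt : ~ P t) :
  rmul (frac x ns) (frac y nt) = frac (x * y) (notPM ns nt).
Proof. exact: rmulE. Qed.

Lemma frac_eq x s y t (ns : ~ P s) (nt : ~ P t) :
  x * t = y * s -> frac x ns = frac y nt.
Proof. by move=> xt; apply/frac_eqP; rewrite xt subrr. Qed.

Lemma raddA : associative radd.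
Proof.
elim/residue_ind => x s ns; elim/residue_ind => y t nt; elim/residue_ind => z u nu.
by rewrite !raddM; apply: frac_eq; ring.
Qed.

Lemma raddC : commutative radd.
Proof.
elim/residue_ind => x s ns; elim/residue_ind => y t nt.
by rewrite !raddM; apply: frac_eq; ring.
Qed.

Lemma radd0 : left_id rzero radd.
Proof. by elim/residue_ind => x s ns; rewrite raddM; apply: frac_eq; ring. Qed.

Lemma raddN : left_inverse rzero ropp radd.
Proof. by elim/residue_ind => x s ns; rewrite roppE raddM; apply: frac_eq; ring. Qed.

HB.instance Definition _ := GRing.isZmodule.Build residue raddA raddC radd0 raddN.

Lemma rmulA : associative rmul.
Proof.
elim/residue_ind => x s ns; elim/residue_ind => y t nt; elim/residue_ind => z u nu.
by rewrite !rmulM; apply: frac_eq; ring.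
Qed.

Lemma rmulC : commutative rmul.
Proof.
elim/residue_ind => x s ns; elim/residue_ind => y t nt.
by rewrite !rmulM; apply: frac_eq; ring.
Qed.

Lemma rmul1 : left_id rone rmul.
Proof. by elim/residue_ind => x s ns; rewrite rmulM; apply: frac_eq; ring. Qed.

Lemma rmulDl : left_distributive rmul radd.
Proof.
elim/residue_ind => x s ns; elim/residue_ind => y t nt; elim/residue_ind => z u nu.
by rewrite !(raddM, rmulM); apply: frac_eq; ring.
Qed.

Lemma rone_neq0 : rone != rzero.
Proof.
by apply/eqP => /frac_eqP; rewrite mulr1 mul0r subr0; exact: dprime1 PP.
Qed.

HB.instance Definition _ := GRing.Zmodule_isComNzRing.Build residue
  rmulA rmulC rmul1 rmulDl rone_neq0.

Definition rinv (k : residue) : residue :=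
  if pselect (P (num k)) is right nP then frac (den k) nP else 0.

Lemma frac_eq0 x s (ns : ~ P s) : frac x ns = 0 <-> P x.
Proof. by rewrite frac_eqP mulr1 mul0r subr0. Qed.

Lemma rmulV k : k != 0 -> rinv k * k = 1.
Proof.
rewrite /rinv => k0; case: pselect => [Pk|nPk].
  by case/eqP: k0; rewrite [k]frac_repr; apply/frac_eq0.
rewrite [k in X in _ * X = _]frac_repr -[LHS]/(rmul _ _) rmulM.
by apply: frac_eq; ring.
Qed.

Lemma rinv0 : rinv 0 = 0.
Proof.
rewrite /rinv; case: pselect => // nP0; case: nP0.
by have := @frac_numden 0 1 (dprime1 PP); rewrite mulr1 mul0r subr0.
Qed.

HB.instance Definition _ := GRing.ComNzRing_isField.Build residue rmulV rinv0.

Definition to_residue x : residue := frac x (dprime1 PP).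

Lemma to_residueB : zmod_morphism to_residue.
Proof.
move=> x y; rewrite -[RHS]/(radd _ (ropp _)) roppE raddM; apply: frac_eq; ring.
Qed.

Lemma to_residueM : monoid_morphism to_residue.
Proof.
by split=> // x y; rewrite -[RHS]/(rmul _ _) rmulM; apply: frac_eq; ring.
Qed.

HB.instance Definition _ := GRing.isZmodMorphism.Build R residue to_residue to_residueB.
HB.instance Definition _ := GRing.isMonoidMorphism.Build R residue to_residue to_residueM.

Lemma rderM x s (ns : ~ P s) :
  rder (frac x ns) = frac (s ^+ q * d x - x ^+ q * d s) (notPX (k := (q * 2)%N) ns).
Proof. exact: rderE. Qed.

Lemma frac_pow x s (ns : ~ P s) k : frac x ns ^+ k = frac (x ^+ k) (notPX (k := k) ns).
Proof.
elim: k => [|k IH]; first by apply: frac_eq; rewrite !expr0.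
rewrite exprS IH -[LHS]/(rmul _ _) rmulM; apply: frac_eq; rewrite !exprS; ring.
Qed.

Lemma rder_derivation : frobenius_derivation q rder.
Proof.
split; elim/residue_ind => x s ns; elim/residue_ind => y t nt.
  rewrite -[frac x ns + _]/(radd _ _) -[RHS]/(radd _ _) !(raddM, rderM).
  apply: frac_eq; rewrite powD dP.1 !dP.2 !exprM !exprMn; ring.
rewrite -[frac x ns * _]/(rmul _ _) !frac_pow !(rmulM, rderM).
rewrite -[RHS]/(radd (rmul _ _) (rmul _ _)) !rmulM raddM.
apply: frac_eq; rewrite !dP.2 !exprM !exprMn; ring.
Qed.

Lemma rder_to_residue x : rder (to_residue x) = to_residue (d x).
Proof.
rewrite /to_residue rderM; apply: frac_eq.
rewrite (fder1 dP) !expr1n; ring.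
Qed.

End ResidueField.

Lemma differential_residue_field q (R : comNzRingType) (d : R -> R) (P : R -> Prop) :
  (0 < q)%N -> {morph (fun x : R => x ^+ q) : x y / x + y} ->
  frobenius_derivation q d -> differential_prime d P ->
  exists (K : fieldType) (dK : K -> K) (h : {rmorphism R -> K}),
    [/\ frobenius_derivation q dK, forall x, dK (h x) = h (d x)
      & forall x, P x -> h x = 0].
Proof.
move=> q0 powD dP PP.
exists (residue PP), (@rder q R d P PP), (@to_residue R d P PP).
split=> [|x|x Px]; first exact: rder_derivation.
- exact: rder_to_residue.
- exact/frac_eq0.
Qed.

(** * Differential primes of reduced rings *)

Section ReducedLocalization.
Variables (q : nat) (R : comNzRingType) (d : R -> R).
Hypothesis q_gt0 : (0 < q)%N.
Hypothesis powD : {morph (fun x : R => x ^+ q) : x y / x + y}.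
Hypothesis dP : frobenius_derivation q d.
Hypothesis reduced : forall (x : R) k, x ^+ k = 0 -> x = 0.

(** Sets all of whose finite products are nonzero.  The empty set is one of
    them, as is the union of any chain of them, so there is a maximal one; it is
    a multiplicative set avoiding 0. *)
Definition prod_free (S : set R) :=
  forall s : seq R, (forall x, x \in s -> S x) -> \prod_(x <- s) x != 0.

(** If x lies outside a maximal set S, adding x creates a vanishing product
    x^k s with s a product of elements of S; then (x s)^(k+1) = 0, so x s = 0 in
    a reduced ring. *)
Lemma maximal_prod_free : exists S : set R,
  [/\ S 1, forall x y, S x -> S y -> S (x * y), ~ S 0
    & forall x, ~ S x -> exists2 s, S s & x * s = 0].
Proof.
have [C CC Ctot|S [Sfree Smax]] := @Zorn_bigcup R prod_free.
  move=> s sC.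
  have : s = [::] \/ exists2 X, C X & forall x, x \in s -> X x.
    elim: s sC => [|x s IH] sC; [by left|right].
    have [|X CX Xx] := sC x; first exact: mem_head.
    have [|s0|[Y CY Ys]] := IH.
    - by move=> y ys; apply: sC; rewrite inE ys orbT.
    - by exists X => // y; rewrite s0 inE => /eqP ->.
    have [XY|YX] := Ctot _ _ CX CY.
      by exists Y => // y; rewrite inE => /predU1P[->|/Ys//]; exact: XY.
    by exists X => // y; rewrite inE => /predU1P[->//|/Ys]; exact: YX.
  by move=> [->|[X /CC]]; [rewrite big_nil oner_eq0|exact].
have out x : ~ S x -> exists s : seq R, (forall y, y \in s -> S y) /\
    x * \prod_(y <- s) y = 0.
  move=> nSx; apply: contrapT => nex.
  apply: (Smax (S `|` [set x])%classic).
    split; first by move=> y; left.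
    by move=> /(_ x (or_intror erefl)).
  move=> s sSx.
  have [k [t [tS ->]]] : exists k (t : seq R), (forall y, y \in t -> S y) /\
      \prod_(y <- s) y = x ^+ k * \prod_(y <- t) y.
    elim: s sSx => [|y s IH] sSx; first by exists 0%N, [::]; rewrite !big_nil mulr1.
    have [|k [t [tS st]]] := IH; first by move=> z zs; apply: sSx; rewrite inE zs orbT.
    have [Sy|->] := sSx y (mem_head _ _).
      exists k, (y :: t); split; first by move=> z; rewrite inE => /predU1P[->//|/tS].
      by rewrite !big_cons st mulrCA.
    by exists k.+1, t; split=> //; rewrite big_cons st exprS mulrA.
  apply/eqP => xt0; apply: nex; exists t; split=> //.
  apply: (@reduced _ k.+1); move: (\prod_(y <- t) y) xt0 => z xz.
  have -> : (x * z) ^+ k.+1 = (x ^+ k * z) * (x * z ^+ k) by rewrite exprMn !exprS; ring.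
  by rewrite xz mul0r.
have S_mem x : (forall s : seq R, (forall y, y \in s -> S y) -> x * \prod_(y <- s) y != 0) -> S x.
  move=> Hx; apply: contrapT => /out[s [sS /eqP]]; apply/negP; exact: Hx.
have SM x y : S x -> S y -> S (x * y).
  move=> Sx Sy; apply: S_mem => s sS; have := Sfree [:: x, y & s].
  rewrite !big_cons mulrA; apply=> z; rewrite !inE.
  by move=> /or3P[/eqP ->|/eqP ->|/sS].
have S1 : S 1 by apply: S_mem => s sS; rewrite mul1r; exact: Sfree.
exists S; split=> //.
  move=> S0; have := Sfree [:: 0]; rewrite big_seq1 eqxx => /(_ _)/negP; apply=> //.
  by move=> x; rewrite inE => /eqP ->.
move=> x /out[s [sS xs]]; exists (\prod_(y <- s) y) => //.
elim: s sS {xs} => [|y s IH] sS; first by rewrite big_nil.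
rewrite big_cons; apply: SM; first by apply: sS; exact: mem_head.
by apply: IH => z zs; apply: sS; rewrite inE zs orbT.
Qed.

(** The complement of the set S of [maximal_prod_free] is a minimal prime, and
    its elements are those killed by an element of S.  Deriving x s = 0 gives
    x^q d(s) + s^q d(x) = 0; multiplication by s removes the first term, so
    s^(q+1) kills d(x). *)
Lemma reduced_differential_prime : exists P : R -> Prop, differential_prime d P.
Proof.
have [S [S1 SM S0 Sout]] := maximal_prod_free.
have notS x s : S s -> x * s = 0 -> ~ S x.
  by move=> Ss xs Sx; apply: S0; rewrite -xs; exact: SM.
exists (fun x => ~ S x); split=> //.
- move=> x y /Sout[s Ss xs] /Sout[t St yt]; apply: (notS _ (s * t)); first exact: SM.
  by rewrite mulrDl mulrA xs mul0r add0r mulrCA yt mulr0.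
- by move=> x y /Sout[s Ss xs]; apply: (notS _ s) => //; rewrite mulrAC xs mul0r.
- by move=> x y; apply: contraPP => /not_orP[/contrapT Sx /contrapT Sy] /(_ (SM _ _ Sx Sy)).
- move=> x /Sout[s Ss xs].
  have SX k : S (s ^+ k) by elim: k => [//|k IH]; rewrite exprS; exact: SM.
  apply: (notS _ (s ^+ q * s)); first exact: SM.
  have := congr1 (fun z => z * s) (congr1 d xs).
  rewrite dP.2 (fder0 dP) mul0r mulrDl => e; rewrite -[RHS]e.
  rewrite -(prednK q_gt0) !exprS.
  have -> : x * x ^+ q.-1 * d s * s = x * s * (x ^+ q.-1 * d s) by ring.
  rewrite xs mul0r add0r; ring.
Qed.

End ReducedLocalization.

(** * Amalgamation over a field whose constants are p-th powers *)

Section Independence.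
Variables (F N : fieldType) (j : {rmorphism F -> N}) (m : nat).

Definition independent (y : 'I_m -> N) (J : {set 'I_m}) :=
  forall c : 'I_m -> F, supported J c -> \sum_l j (c l) * y l = 0 ->
    forall l, c l = 0.

(** A maximal independent subfamily spans. *)
Lemma independent_basis (y : 'I_m -> N) :
  exists (J : {set 'I_m}) (a : 'I_m -> 'I_m -> F),
    [/\ independent y J, forall k, supported J (a k)
      & forall k, y k = \sum_l j (a k l) * y l].
Proof.
have ind0 : `[< independent y finset.set0 >].
  by apply/asboolP => c c0 _ l; apply: c0; rewrite inE.
case: (@arg_maxnP _ _ (fun J => `[< independent y J >]) (fun J : {set 'I_m} => #|J|) ind0) => J /asboolP indJ maxJ.
have delta k : \sum_l j ((l == k)%:R) * y l = y k.
  rewrite (bigD1 k) //= eqxx rmorph1 mul1r big1 ?addr0 // => l lk.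
  by rewrite (negPf lk) rmorph0 mul0r.
have coef k : exists c : 'I_m -> F, supported J c /\ y k = \sum_l j (c l) * y l.
  have [kJ|kJ] := boolP (k \in J).
    exists (fun l => (l == k)%:R); split; last by rewrite delta.
    by move=> l lJ; case: eqP => // lk; rewrite lk kJ in lJ.
  have : ~ independent y (k |: J).
    move=> /asboolP ind; have := maxJ _ ind.
    by rewrite cardsU1 kJ add1n /= ltnn.
  move=> nind; have [c [cJ c0 [l cl]]] : exists c, [/\ supported (k |: J) c,
      \sum_l j (c l) * y l = 0 & exists l, c l != 0].
    apply: contrapT => nc; apply: nind => c cJ c0 l.
    by apply/eqP; apply: contrapT => /negP cl; apply: nc; exists c; split=> //; exists l.
  have ck : c k != 0.
    apply/negP => /eqP ck; case/eqP: cl; apply: indJ => // x xJ.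
    have [->//|xk] := eqVneq x k.
    by apply: cJ; rewrite !inE (negPf xk).
  exists (fun x => if x == k then 0 else - (c x / c k)); split.
    move=> x xJ; case: eqP => // /eqP xk; rewrite cJ ?mul0r ?oppr0 //.
    by rewrite !inE (negPf xk).
  have := congr1 (fun z => z / j (c k)) c0; rewrite mul0r (bigD1 k) //= mulrDl.
  rewrite mulrAC mulfV ?fmorph_eq0 // mul1r => /eqP; rewrite addr_eq0 => /eqP ->.
  rewrite [RHS](bigD1 k) //= eqxx rmorph0 mul0r add0r mulr_suml -sumrN.
  apply: eq_bigr => x xk; rewrite (negPf xk) rmorphN fmorph_div; ring.
have [a aP] := choice coef.
by exists J, a; split=> // k; case: (aP k).
Qed.
End Independence.

Section Amalgam.
Variables (p n : nat) (F M N : fieldType).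
Variables (i : {rmorphism F -> M}) (j : {rmorphism F -> N}).
Hypothesis charF : p \in [pchar F].
Let charM : p \in [pchar M]. Proof. by rewrite (fmorph_pchar i). Qed.
Let charN : p \in [pchar N]. Proof. by rewrite (fmorph_pchar j). Qed.
Let q := (p ^ n)%N.
Variables (dF : F -> F) (dM : M -> M) (dN : N -> N).
Hypothesis dFP : frobenius_derivation q dF.
Hypothesis dMP : frobenius_derivation q dM.
Hypothesis dNP : frobenius_derivation q dN.
Hypothesis i_der : forall x, i (dF x) = dM (i x).
Hypothesis j_der : forall x, j (dF x) = dN (j x).
Hypothesis strict : forall x, dF x = 0 -> exists y, x = y ^+ p.

Let T := tensor i j.
Let pr x y : T := pure i j x y.
Let p_pr : prime p. Proof. exact: pcharf_prime charF. Qed.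

Let prDl y : {morph pr^~ y : x x' / x + x'}.
Proof. by case: (pure_balanced i j). Qed.
Let prDr x : {morph pr x : y y' / y + y'}.
Proof. by case: (pure_balanced i j). Qed.
Let prZ a x y : pr (i a * x) y = pr x (j a * y).
Proof. by case: (pure_balanced i j). Qed.
Let pr0l y : pr 0 y = 0. Proof. exact: balanced0l (pure_balanced i j). Qed.
Let pr0r x : pr x 0 = 0. Proof. exact: balanced0r (pure_balanced i j). Qed.
Let prM x y x' y' : pr x y * pr x' y' = pr (x * x') (y * y').
Proof. exact: tensor_mul_pure. Qed.
Let prX x y k : pr x y ^+ k = pr (x ^+ k) (y ^+ k).
Proof. by elim: k => [//|k IH]; rewrite !exprS IH prM. Qed.

Definition to_left (x : M) : T := pr x 1.
Definition to_right (y : N) : T := pr 1 y.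

Lemma to_leftB : zmod_morphism to_left.
Proof. by move=> x y; rewrite /to_left prDl; congr (_ + _); exact: balancedNl (pure_balanced i j). Qed.
Lemma to_leftM : monoid_morphism to_left.
Proof. by split=> // x y; rewrite /to_left prM mulr1. Qed.
Lemma to_rightB : zmod_morphism to_right.
Proof.
by move=> x y; apply/eqP; rewrite eq_sym subr_eq /to_right -prDr subrK.
Qed.
Lemma to_rightM : monoid_morphism to_right.
Proof. by split=> // x y; rewrite /to_right prM mulr1. Qed.

HB.instance Definition _ := GRing.isZmodMorphism.Build M T to_left to_leftB.
HB.instance Definition _ := GRing.isMonoidMorphism.Build M T to_left to_leftM.
HB.instance Definition _ := GRing.isZmodMorphism.Build N T to_right to_rightB.
HB.instance Definition _ := GRing.isMonoidMorphism.Build N T to_right to_rightM.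

Lemma pchar_tensor : p \in [pchar T].
Proof. exact: (rmorph_pchar to_left charM). Qed.

(** Write z = sum X_l (x) y_l with the y_l independent over F.  Then
    z^p = sum X_l^p (x) y_l^p = 0.  Let the y_l^p be expanded in a basis of their
    span, with coefficients a'; by [tensor_zero_functional] the X_l^p satisfy the
    linear equations given by the columns of a'.  If X were nonzero,
    [frobenius_descent] would give a nonzero b in F with b_l^p satisfying the same
    equations, hence sum b_l^p y_l^p = 0, and taking the p-th root
    sum b_l y_l = 0, against independence. *)
Lemma tensor_reduced_p (z : T) : z ^+ p = 0 -> z = 0.
Proof.
set m := size (repr z).
pose x k := (nth (0, 0) (repr z) (k : 'I_m)).1.
pose y k := (nth (0, 0) (repr z) (k : 'I_m)).2.
have zE : z = \sum_k pr (x k) (y k).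
  by rewrite {1}[z]tensor_repr (big_nth (0, 0)) big_mkord.
have [J [a [indJ aJ ya]]] := independent_basis j y.
pose X l := \sum_k i (a k l) * x k.
have XJ l : l \notin J -> X l = 0.
  by move=> lJ; apply: big1 => k _; rewrite aJ // rmorph0 mul0r.
have prsuml (I : finType) (E : I -> M) w : pr (\sum_k E k) w = \sum_k pr (E k) w.
  exact: (big_morph (pr^~ w) (prDl w) (pr0l w)).
have prsumr (I : finType) (E : I -> N) w : pr w (\sum_k E k) = \sum_k pr w (E k).
  exact: (big_morph (pr w) (prDr w) (pr0r w)).
have {}zE : z = \sum_l pr (X l) (y l).
  rewrite zE; transitivity (\sum_k \sum_l pr (i (a k l) * x k) (y l)).
    apply: eq_bigr => k _; rewrite {1}ya prsumr; apply: eq_bigr => l _.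
    by rewrite prZ.
  by rewrite exchange_big; apply: eq_bigr => l _; rewrite prsuml.
have zpE : z ^+ p = \sum_l pr (X l ^+ p) (y l ^+ p).
  rewrite zE -{1}(expn1 p) (pchar_pow_sum _ _ _ _ pchar_tensor) expn1.
  by apply: eq_bigr => l _; rewrite prX.
move=> zp0; rewrite zpE in zp0.
have [J' [a' [indJ' aJ' ya']]] := independent_basis j (fun l => y l ^+ p).
have sys l' : \sum_k X k ^+ p * i (a' k l') = 0.
  apply: (tensor_zero_functional zp0) => c c0.
  apply: (indJ' (fun l => \sum_k c k * a' k l)) => [l lJ|].
    by apply: big1 => k _; rewrite aJ' // mulr0.
  rewrite -[RHS]c0.
  transitivity (\sum_l \sum_k j (c k) * (j (a' k l) * y l ^+ p)).
    apply: eq_bigr => l _; rewrite rmorph_sum mulr_suml; apply: eq_bigr => k _.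
    by rewrite rmorphM mulrA.
  by rewrite exchange_big; apply: eq_bigr => k _; rewrite -mulr_sumr -ya'.
suff X0 k : X k = 0 by rewrite zE big1 // => l _; rewrite X0 pr0l.
apply/eqP; apply: contrapT => /negP Xk.
(* besides the columns of a', equations that keep b inside the support J *)
pose s := [seq [ffun k => a' k l] | l <- enum 'I_m] ++
  [seq [ffun l => (l == k')%:R : F] | k' <- enum (~: J)].
have [||b [[k0 bk0] bs]] := frobenius_descent charF dFP dMP i_der strict (s := s) (c := X).
- move=> f; rewrite mem_cat => /orP[] /mapP[l lJ ->].
    by rewrite -[RHS](sys l); apply: eq_bigr => k' _; rewrite ffunE.
  rewrite pairing_delta XJ ?expr0n ?(negPf (lt0n_neq0 (prime_gt0 p_pr))) //.
  by move: lJ; rewrite mem_enum inE.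
- by exists k.
have bJ : supported J b.
  move=> l lJ; have := bs [ffun x => (x == l)%:R].
  rewrite mem_cat map_f ?orbT ?mem_enum ?inE // => /(_ isT).
  rewrite (bigD1 l) //= ffunE eqxx mulr1 big1 ?addr0 => [|w wl].
    by move=> /eqP; rewrite expf_eq0 => /andP[_ /eqP].
  by rewrite ffunE (negPf wl) mulr0.
case/eqP: bk0; apply: (indJ b bJ).
suff : (\sum_l j (b l) * y l) ^+ (p ^ 1) == 0.
  by rewrite expf_eq0 => /andP[_ /eqP].
rewrite (pchar_pow_sum _ _ _ _ charN) expn1; apply/eqP.
transitivity (\sum_k \sum_l j (b k ^+ p * a' k l) * y l ^+ p).
  apply: eq_bigr => l _; rewrite exprMn {1}ya' mulr_sumr; apply: eq_bigr => x' _.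
  by rewrite rmorphM rmorphXn mulrA.
rewrite exchange_big big1 // => l _; rewrite -mulr_suml -rmorph_sum.
have := bs [ffun k => a' k l]; rewrite mem_cat map_f ?mem_enum // => /(_ isT).
rewrite (eq_bigr (fun k => b k ^+ p * a' k l)) => [->|x' _]; last by rewrite ffunE.
by rewrite rmorph0 mul0r.
Qed.

Lemma tensor_reduced (z : T) k : z ^+ k = 0 -> z = 0.
Proof.
move=> zk; have {zk} : z ^+ (p ^ k) = 0.
  by rewrite -(subnK (ltnW (ltn_expl k (prime_gt1 p_pr)))) exprD zk mulr0.
elim: k => [|k IH]; first by rewrite expn0 expr1.
by rewrite expnSr exprM => /tensor_reduced_p.
Qed.

Let powDM : {morph (fun x : M => x ^+ q) : x y / x + y}.
Proof. exact: pchar_powD. Qed.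
Let powDN : {morph (fun x : N => x ^+ q) : x y / x + y}.
Proof. exact: pchar_powD. Qed.
Let powDT : {morph (fun x : T => x ^+ q) : x y / x + y}.
Proof. exact: pchar_powD pchar_tensor. Qed.

(** The Leibniz rule for x (x) y = (x (x) 1)(1 (x) y). *)
Definition pure_der x y : T := pr (x ^+ q) (dN y) + pr (dM x) (y ^+ q).

Lemma pure_der_balanced : balanced i j pure_der.
Proof.
split=> [y x x'|x y y'|a x y]; rewrite /pure_der.
- by rewrite powDM dMP.1 !prDl addrACA.
- by rewrite powDN dNP.1 !prDr addrACA.
rewrite dMP.2 dNP.2 !exprMn prDl prDr -!rmorphXn -i_der -j_der.
rewrite ![_ * i _]mulrC ![_ * j _]mulrC !prZ; ring.
Qed.

Definition tensor_der : T -> T := tensor_lift pure_der.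

Lemma tensor_der_pure x y : tensor_der (pr x y) = pure_der x y.
Proof. exact: tensor_lift_pure pure_der_balanced. Qed.

Lemma tensor_der_derivation : frobenius_derivation q tensor_der.
Proof.
have dD : {morph tensor_der : x y / x + y} by exact: tensor_liftD pure_der_balanced.
have d0 : tensor_der 0 = 0.
  by apply: (addrI (tensor_der 0)); rewrite -dD !addr0.
have q0 : (0 ^+ q = 0 :> T).
  by rewrite expr0n /q expn_eq0 (negPf (lt0n_neq0 (prime_gt0 p_pr))).
split=> // z z'.
elim/tensor_ind: z => [|z1 z2 IH1 IH2|x y].
- by rewrite q0 d0 !mul0r d0 mulr0 addr0.
- by rewrite mulrDl !dD IH1 IH2 powDT; ring.
elim/tensor_ind: z' => [|z1 z2 IH1 IH2|x' y'].
- by rewrite q0 d0 !mulr0 d0 mul0r addr0.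
- by rewrite mulrDr !dD IH1 IH2 powDT; ring.
rewrite -![pure _ _ _ _]/(pr _ _) prM !tensor_der_pure /pure_der !prX dMP.2 dNP.2.
rewrite !exprMn !mulrDr !prM prDl prDr.
rewrite [x' ^+ q * x ^+ q]mulrC [y' ^+ q * y ^+ q]mulrC; ring.
Qed.

Lemma tensor_der_left x : tensor_der (to_left x) = to_left (dM x).
Proof.
by rewrite tensor_der_pure /pure_der (fder1 dNP) pr0r add0r expr1n.
Qed.

Lemma tensor_der_right y : tensor_der (to_right y) = to_right (dN y).
Proof.
by rewrite tensor_der_pure /pure_der (fder1 dMP) pr0l addr0 expr1n.
Qed.

Lemma differential_amalgam : exists (K : fieldType) (dK : K -> K)
    (h : {rmorphism M -> K}) (g : {rmorphism N -> K}),
  [/\ frobenius_derivation q dK, forall x, dK (h x) = h (dM x),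
      forall y, dK (g y) = g (dN y) & forall a, h (i a) = g (j a)].
Proof.
have q0 : (0 < q)%N by rewrite expn_gt0 (prime_gt0 p_pr).
have [P PP] := reduced_differential_prime q0 tensor_der_derivation tensor_reduced.
have [K [dK [h [dKP hd _]]]] :=
  differential_residue_field q0 powDT tensor_der_derivation PP.
exists K, dK, (h \o to_left : {rmorphism M -> K}), (h \o to_right : {rmorphism N -> K}).
split=> //=.
- by move=> x; rewrite hd tensor_der_left.
- by move=> y; rewrite hd tensor_der_right.
- by move=> a; rewrite /to_left -[i a]mulr1 prZ mulr1.
Qed.

End Amalgam.

(** * Adjoining a p-th root of a constant *)

Section AdjoinRoot.
Variables (p n : nat) (K : fieldType) (d : K -> K) (x : K).
Hypothesis charK : p \in [pchar K].
Let q := (p ^ n)%N.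
Hypothesis dP : frobenius_derivation q d.
Hypothesis dx0 : d x = 0.
Hypothesis nroot : forall y, y ^+ p != x.

Let p_pr : prime p. Proof. exact: pcharf_prime charK. Qed.
Let p_gt0 : (0 < p)%N. Proof. exact: prime_gt0. Qed.
Let q_gt0 : (0 < q)%N. Proof. by rewrite expn_gt0 p_gt0. Qed.
Let charP : p \in [pchar {poly K}]. Proof. exact: (rmorph_pchar (polyC : {rmorphism K -> {poly K}}) charK). Qed.
Let Fr : {rmorphism K -> K} := pFrobenius_aut charK.
Let powD : {morph (fun f : {poly K} => f ^+ q) : f g / f + g}.
Proof. exact: pchar_powD charP. Qed.

(** The derivation of K[X] that extends d and kills X: it sends a X^k to
    d(a) X^(q k). *)
Definition poly_der (f : {poly K}) : {poly K} := map_poly d f \Po 'X^q.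

Let coef_d f k : (map_poly d f)`_k = d f`_k.
Proof. exact: coef_map_id0 (fder0 dP). Qed.

Let poly_derD : {morph poly_der : f g / f + g}.
Proof.
move=> f g; rewrite /poly_der -comp_polyD; congr (_ \Po _).
by apply/polyP => k; rewrite !coefD !coef_d coefD dP.1.
Qed.

Let poly_derC c : poly_der c%:P = (d c)%:P.
Proof.
rewrite /poly_der (_ : map_poly d c%:P = (d c)%:P) ?comp_polyC //.
by apply/polyP => k; rewrite coef_d !coefC; case: eqP => // _; exact: fder0 dP.
Qed.

Let poly_derMX f : poly_der (f * 'X) = poly_der f * 'X^q.
Proof.
rewrite /poly_der (_ : map_poly d (f * 'X) = map_poly d f * 'X).
  by rewrite comp_polyM comp_polyX.
by apply/polyP => k; rewrite coef_d !coefMX coef_d; case: eqP => // _; exact: fder0 dP.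
Qed.

Let poly_der0 : poly_der 0 = 0.
Proof. by rewrite -polyC0 poly_derC (fder0 dP). Qed.

Let q0 : (0 ^+ q = 0 :> {poly K}).
Proof. by rewrite expr0n expn_eq0 (negPf (lt0n_neq0 p_gt0)). Qed.

Lemma poly_der_derivation : frobenius_derivation q poly_der.
Proof.
split=> // f g; elim/poly_ind: f => [|f c IHf].
  by rewrite mul0r poly_der0 q0 mul0r mulr0 addr0.
have cg : poly_der (c%:P * g) = c%:P ^+ q * poly_der g + g ^+ q * (d c)%:P.
  elim/poly_ind: g {IHf} => [|g b IHg].
    by rewrite mulr0 poly_der0 q0 mul0r mulr0 addr0.
  rewrite mulrDr mulrA !poly_derD !poly_derMX IHg -polyCM !poly_derC powD dP.2.
  rewrite rmorphD !rmorphM !rmorphXn /= exprMn; ring.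
rewrite mulrDl mulrAC !poly_derD !poly_derMX IHf cg poly_derC powD exprMn; ring.
Qed.

Let phi (f : {poly K}) := (map_poly Fr f).[x].

(** X^p - x is irreducible, and its root is x^(1/p).  That f vanishes there is
    expressed in K, after raising to the p-th power: the polynomial with
    coefficients f_k^p vanishes at x.  The gcd g of f and X^p - x becomes, when
    its coefficients are raised to the p-th power, a divisor of (X - x)^p, hence
    proportional to some (X - x)^k with k > 0.  If k < p, the two leading
    coefficients of g exhibit x as a p-th power; so k = p and g is X^p - x. *)
Lemma frobenius_root_dvd (f : {poly K}) : phi f = 0 -> 'X^p - x%:P %| f.
Proof.
move=> f0; set Q := 'X^p - x%:P.
have sQ : size Q = p.+1 by rewrite size_XnsubC.
have FQ : map_poly Fr Q = ('X - x%:P) ^+ p.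
  rewrite rmorphB /= map_polyXn map_polyC /= -[in RHS]pFrobenius_autE rmorphB /=.
  by rewrite !pFrobenius_autE -polyC_exp.
pose g := gcdp f Q.
have gQ : g %| Q := dvdp_gcdr f Q.
have /dvdp_exp_XsubCP[k kp gk] : map_poly Fr g %| ('X - x%:P) ^+ p.
  by rewrite -FQ dvdp_map.
have sg : size g = k.+1.
  by rewrite -(size_map_poly Fr) (eqp_size gk) size_exp_XsubC.
have k0 : (0 < k)%N.
  rewrite lt0n; apply/eqP => k0.
  have : root (map_poly Fr g) x.
    rewrite gcdp_map root_gcd /root -/(phi f) f0 eqxx FQ horner_exp hornerXsubC.
    by rewrite subrr expr0n (negPf (lt0n_neq0 p_gt0)) eqxx.
  by rewrite (eqp_root gk) k0 expr0 /root hornerC oner_eq0.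
have [k_eq|k_neq] := eqVneq k p.
  have : g %= Q by rewrite -(dvdp_size_eqp gQ) sg k_eq sQ.
  by move=> /eqp_dvdl <-; exact: dvdp_gcdl.
have kltp : (k < p)%N by rewrite ltn_neqAle k_neq.
case/eqpP: gk => -[c1 c2] /= /andP[c10 c20] eqg.
have kK : k%:R != 0 :> K.
  by rewrite -(dvdn_pcharf charK) gtnNdvd.
have coefs l : c1 * g`_l ^+ p = c2 * (('X - x%:P) ^+ k)`_l.
  have := congr1 (fun h : {poly K} => h`_l) eqg.
  by rewrite !coefZ coef_map /= pFrobenius_autE.
have prodE : ('X - x%:P) ^+ k = \prod_(y <- nseq k x) ('X - y%:P).
  by rewrite big_nseq -Monoid.iteropE.
have lead : c1 * g`_k ^+ p = c2.
  rewrite coefs -{2}[k]/(k.+1.-1) -(size_exp_XsubC k x) -lead_coefE.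
  by rewrite lead_coef_exp lead_coefXsubC expr1n mulr1.
have sub : c1 * g`_k.-1 ^+ p = - (c2 * (x *+ k)).
  have := @coefPn_prod_XsubC _ (nseq k x); rewrite size_nseq -lt0n => /(_ k0).
  rewrite -prodE coefs => ->; rewrite big_nseq mulrN; congr (- (_ * _)).
  by elim: (k) => [//|l IH] /=; rewrite IH mulrS.
have gk0 : g`_k != 0.
  apply/eqP => gk0; case/eqP: c20.
  by rewrite -lead gk0 expr0n (negPf (lt0n_neq0 p_gt0)) mulr0.
case/eqP: (nroot (- (g`_k.-1 / (k%:R * g`_k)))).
rewrite (pchar_expN _ charK) exprMn exprVn exprMn.
have -> : k%:R ^+ p = k%:R :> K by rewrite -(pFrobenius_autE charK) rmorph_nat.
have -> : g`_k.-1 ^+ p = - (g`_k ^+ p * (x *+ k)).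
  apply: (mulfI c10); rewrite sub -lead; ring.
rewrite mulNr opprK -mulr_natr; field.
by rewrite kK expf_neq0.
Qed.

(** The ideal of X^p - x is stable under [poly_der], because the derivation kills
    X^p and x; its residue field is K(x^(1/p)). *)
Lemma adjoin_root_of_constant :
  exists (L : fieldType) (dL : L -> L) (h : {rmorphism K -> L}) (y : L),
  [/\ frobenius_derivation q dL, forall z, dL (h z) = h (d z) & y ^+ p = h x].
Proof.
have phi0 : phi ('X^p - x%:P) = 0.
  rewrite /phi rmorphB /= map_polyXn map_polyC hornerD hornerN hornerXn hornerC.
  by rewrite /= pFrobenius_autE subrr.
have phiM f g : phi (f * g) = phi f * phi g by rewrite /phi rmorphM hornerM.
have PP : differential_prime poly_der (fun f => phi f = 0).
  split.
  - by rewrite /phi rmorph0 horner0.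
  - by move=> f g f0 g0; rewrite /phi rmorphD hornerD -!/(phi _) f0 g0 addr0.
  - by move=> f g f0; rewrite phiM f0 mul0r.
  - by rewrite /phi rmorph1 hornerC => /eqP; rewrite oner_eq0.
  - by move=> f g /eqP; rewrite phiM mulf_eq0 => /orP[]/eqP; [left|right].
  move=> f /frobenius_root_dvd/dvdpP[g ->].
  have -> : poly_der (g * ('X^p - x%:P)) = ('X^p - x%:P) ^+ q * poly_der g.
    rewrite poly_der_derivation.2 (fderB poly_der_derivation) poly_derC dx0 polyC0.
    by rewrite (fder_pow poly_der_derivation) ?(pcharf0 charP) // subrr mulr0 add0r.
  by rewrite -(prednK q_gt0) exprS -mulrA phiM phi0 mul0r.
have [L [dL [h [dLP hd hP]]]] :=
  differential_residue_field q_gt0 powD poly_der_derivation PP.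
exists L, dL, (h \o polyC : {rmorphism K -> L}), (h 'X); split=> //= [z|].
  by rewrite hd poly_derC.
by apply/eqP; rewrite -subr_eq0 -rmorphXn -rmorphB hP.
Qed.

End AdjoinRoot.

(** * Fields as structures *)

Definition first_arg : 'I_2 := @Ordinal 2 0 isT.
Definition second_arg : 'I_2 := @Ordinal 2 1 isT.

Definition differential_structure (K : pzRingType) (d : K -> K) : structure Ld :=
  @Structure Ld K (fun f => match f return ('I_(@arity Ld f) -> K) -> K with
    | Some Zero => fun=> 0
    | Some One => fun=> 1
    | Some Add => fun a => a first_arg + a second_arg
    | Some Opp => fun a => - a ord0
    | Some Mul => fun a => a first_arg * a second_arg
    | None => fun a => d (a ord0)
    end).

Section FieldToStructure.
Variables (p n : nat) (K : fieldType) (d : K -> K).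
Let S := differential_structure d.

Lemma eval_texp_field k (e : 'I_k -> S) t m :
  eval e (texp t m) = (eval e t : K) ^+ m.
Proof. by rewrite /texp; elim: m => [//|m IH]; rewrite exprS -IH. Qed.

Lemma eval_leibniz_field k (e : 'I_k -> S) t u m :
  eval e (tadd (tmul (texp t m) (tder u)) (tmul (texp u m) (tder t))) =
  (eval e t : K) ^+ m * d (eval e u) + (eval e u : K) ^+ m * d (eval e t) :> K.
Proof. by rewrite -!eval_texp_field. Qed.

Lemma eval_tnat_field k (e : 'I_k -> S) m : eval e (tnat m) = m%:R :> K.
Proof. by rewrite /tnat; elim: m => [//|m IH]; rewrite mulrS -IH. Qed.

Hypothesis charK : p \in [pchar K].
Hypothesis dP : frobenius_derivation (p ^ n) d.

Lemma models_differential_structure : models S (FrDF p n).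
Proof.
move=> phi; case; cbn [sat Neg].
- by move=> x y z; exact: addrA.
- by move=> x y; exact: addrC.
- by move=> x; exact: add0r.
- by move=> x; exact: addNr.
- by move=> x y z; exact: mulrA.
- by move=> x y; exact: mulrC.
- by move=> x; exact: mul1r.
- by move=> x y z; exact: mulrDl.
- by move=> /eqP; apply/negP; exact: oner_neq0.
- move=> x x0; exists (x^-1 : K).
  rewrite [LHS]/= !(env_cons0, env_consS); apply: mulVf; apply/eqP => x00; apply: x0.
  by rewrite /= env_cons0 x00.
- by rewrite eval_tnat_field (pcharf0 charK).
- by move=> x y; exact: dP.1.
- by move=> x y; rewrite eval_leibniz_field; exact: dP.2.
Qed.

End FieldToStructure.

Section StructureToField.
Variables (p n : nat) (M : structure Ld).
Hypothesis p_pr : prime p.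
Hypothesis MT : models M (FrDF p n).

Definition madd (x y : M) : M := @interp Ld M (Some Add) (args2 x y).
Definition mmul (x y : M) : M := @interp Ld M (Some Mul) (args2 x y).
Definition mopp (x : M) : M := @interp Ld M (Some Opp) (args1 x).
Definition mder (x : M) : M := @interp Ld M None (args1 x).
Definition mzero : M := @interp Ld M (Some Zero) (@args0 _).
Definition mone : M := @interp Ld M (Some One) (@args0 _).

Lemma eval_tadd k (e : 'I_k -> M) t u : eval e (tadd t u) = madd (eval e t) (eval e u).
Proof. by rewrite /madd /=; congr interp; apply/funext => i; rewrite /args2; case: ifP. Qed.
Lemma eval_tmul k (e : 'I_k -> M) t u : eval e (tmul t u) = mmul (eval e t) (eval e u).
Proof. by rewrite /mmul /=; congr interp; apply/funext => i; rewrite /args2; case: ifP. Qed.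
Lemma eval_topp k (e : 'I_k -> M) t : eval e (topp t) = mopp (eval e t).
Proof. by []. Qed.
Lemma eval_tder k (e : 'I_k -> M) t : eval e (tder t) = mder (eval e t).
Proof. by []. Qed.
Lemma eval_mzero k (e : 'I_k -> M) : eval e tzero = mzero.
Proof. by rewrite /mzero /=; congr interp; apply/funext => -[]. Qed.
Lemma eval_tone k (e : 'I_k -> M) : eval e tone = mone.
Proof. by rewrite /mone /=; congr interp; apply/funext => -[]. Qed.

Let simp := (eval_tadd, eval_tmul, eval_topp, eval_tder, eval_mzero, eval_tone).
Let var2of3 x y z : eval (env_cons z (env_cons y (env_cons x (@env0 M)))) x2 = x.
Proof. by rewrite /= !(env_consS, env_cons0). Qed.
Let var1of3 x y z : eval (env_cons z (env_cons y (env_cons x (@env0 M)))) x1 = y.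
Proof. by rewrite /= !(env_consS, env_cons0). Qed.
Let var1of2 x y : eval (env_cons y (env_cons x (@env0 M))) x1 = x.
Proof. by rewrite /= !(env_consS, env_cons0). Qed.
Let var0 k (e : 'I_k -> M) x : eval (env_cons x e) x0 = x.
Proof. exact: env_cons0. Qed.
Let vars := (var2of3, var1of3, var1of2, var0).

Lemma maddA : associative madd.
Proof. by move=> x y z; have := MT (FrDF_addA p n) x y z; cbn [sat]; rewrite !simp !vars. Qed.
Lemma maddC : commutative madd.
Proof. by move=> x y; have := MT (FrDF_addC p n) x y; cbn [sat]; rewrite !simp !vars. Qed.
Lemma madd0 : left_id mzero madd.
Proof. by move=> x; have := MT (FrDF_add0 p n) x; cbn [sat]; rewrite !simp !vars. Qed.
Lemma maddN : left_inverse mzero mopp madd.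
Proof. by move=> x; have := MT (FrDF_addN p n) x; cbn [sat]; rewrite !simp !vars. Qed.
Lemma mmulA : associative mmul.
Proof. by move=> x y z; have := MT (FrDF_mulA p n) x y z; cbn [sat]; rewrite !simp !vars. Qed.
Lemma mmulC : commutative mmul.
Proof. by move=> x y; have := MT (FrDF_mulC p n) x y; cbn [sat]; rewrite !simp !vars. Qed.
Lemma mmul1 : left_id mone mmul.
Proof. by move=> x; have := MT (FrDF_mul1 p n) x; cbn [sat]; rewrite !simp !vars. Qed.
Lemma mmulDl : left_distributive mmul madd.
Proof. by move=> x y z; have := MT (FrDF_mulD p n) x y z; cbn [sat]; rewrite !simp !vars. Qed.

(** The proof is a parameter so that the field structure can be attached to this
    type. *)
Definition model_carrier (_ : models M (FrDF p n)) : Type := M.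
Local Notation model_field := (model_carrier MT).
HB.instance Definition _ := gen_eqMixin model_field.
HB.instance Definition _ := gen_choiceMixin model_field.
HB.instance Definition _ := GRing.isZmodule.Build model_field maddA maddC madd0 maddN.

Lemma mone_neq0 : mone != 0 :> model_field.
Proof.
by apply/eqP => H; have := MT (FrDF_neq01 p n); cbn [sat Neg]; rewrite !simp; apply.
Qed.

HB.instance Definition _ := GRing.Zmodule_isComNzRing.Build model_field
  mmulA mmulC mmul1 mmulDl mone_neq0.

Lemma model_field_inv : exists inv : model_field -> model_field,
  (forall x, x != 0 -> inv x * x = 1) /\ inv 0 = 0.
Proof.
have ex (x : model_field) : exists y : model_field, (x != 0 -> y * x = 1) /\ (x = 0 -> y = 0).
  have [->|x0] := eqVneq x 0; first by exists 0; split.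
  have := MT (FrDF_inv p n) x; cbn [sat Neg]; rewrite !simp !vars => -[|y].
    by move=> x00; case/eqP: x0; exact: x00.
  rewrite !simp !vars => xy; exists y; split=> [_|x00]; last by rewrite x00 eqxx in x0.
  exact: xy.
have [inv invP] := choice ex.
by exists inv; split=> [x|]; [exact: (invP x).1|exact: (invP 0).2].
Qed.

Definition minv := projT1 (cid model_field_inv).
Lemma mmulV : forall x, x != 0 -> minv x * x = 1.
Proof. by rewrite /minv; case: cid => ? []. Qed.
Lemma minv0 : minv 0 = 0.
Proof. by rewrite /minv; case: cid => ? []. Qed.

HB.instance Definition _ := GRing.ComNzRing_isField.Build model_field mmulV minv0.

Let K := model_field.

Lemma eval_texp_model k (e : 'I_k -> M) t m : eval e (texp t m) = (eval e t : K) ^+ m :> K.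
Proof.
rewrite /texp; elim: m => [|m IH]; first exact: eval_tone.
by rewrite exprS -IH iterS eval_tmul.
Qed.

Lemma model_pchar : p \in [pchar K].
Proof.
rewrite inE p_pr; apply/eqP.
have <- : eval (@env0 M) (tnat p) = p%:R :> K.
  rewrite /tnat; elim: p => [|m IH]; first exact: eval_mzero.
  by rewrite mulrS -IH iterS eval_tadd eval_tone.
by have := MT (FrDF_char p n); cbn [sat]; rewrite (eval_mzero (@env0 M)).
Qed.

Lemma model_derivation : @frobenius_derivation (p ^ n) K mder.
Proof.
split=> x y.
  by have := MT (FrDF_derD p n) x y; cbn [sat]; rewrite !simp !vars.
have := MT (FrDF_derM p n) x y; cbn [sat].
by rewrite eval_tder !eval_tmul eval_tadd !eval_tmul !eval_tder !eval_texp_model !vars.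
Qed.

End StructureToField.

Lemma field_of_model p n (M : structure Ld) : prime p -> models M (FrDF p n) ->
  exists (K : fieldType) (d : K -> K) (f : M -> K) (g : K -> M),
    [/\ p \in [pchar K], frobenius_derivation (p ^ n) d,
        @embedding Ld M (differential_structure d) f,
        @embedding Ld (differential_structure d) M g & cancel f g /\ cancel g f].
Proof.
move=> p_pr MT; exists (model_carrier MT), (@mder M), id, id.
have hom (s : symb Ld) (a : 'I_(arity s) -> M) :
    @interp Ld (differential_structure (K := model_carrier MT) (@mder M)) s a = interp a.
  case: s a => [[]|] a /=.
  - by congr interp; exact: env0_eq.
  - by congr interp; exact: env0_eq.
  - by congr interp; apply/funext => i; rewrite /args2; case: ifP => i0; congr a; apply/val_inj;
      case: i i0 => -[|[|]].
  - by congr interp; apply/funext => i; rewrite /args1 (ord1 i).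
  - by congr interp; apply/funext => i; rewrite /args2; case: ifP => i0; congr a; apply/val_inj;
      case: i i0 => -[|[|]].
  - by congr interp; apply/funext => i; rewrite /args1 (ord1 i).
split=> //; first exact: model_pchar.
- exact: model_derivation.
- by split=> // s a; rewrite -[LHS]hom.
- by split=> // s a; rewrite [LHS]hom.
Qed.

(** * Amalgamation over a common ring of values *)

Section GraphField.
Variables (M N : fieldType) (A : M -> N -> Prop).
Hypothesis A1 : A 1 1.
Hypothesis AD : forall x y x' y', A x y -> A x' y' -> A (x + x') (y + y').
Hypothesis AN : forall x y, A x y -> A (- x) (- y).
Hypothesis AM : forall x y x' y', A x y -> A x' y' -> A (x * x') (y * y').
Hypothesis A0 : forall x y, A x y -> (x == 0) = (y == 0).

(** The field of fractions of A, as a subring of the product ring M * N: both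
    projections are then ring morphisms, and the hypothesis that coordinates
    vanish together makes this subring a field. *)
Definition fraction_graph : {pred (M * N)%type} := fun z =>
  `[< exists a a' b b', [/\ A a a', A b b', b != 0 & z = (a / b, a' / b')] >].

Lemma fraction_graph_closed : divring_closed fraction_graph.
Proof.
have nz b b' : A b b' -> b != 0 -> b' != 0 by move=> /A0 ->.
split.
- by apply/asboolP; exists 1, 1, 1, 1; rewrite !divr1 oner_neq0.
- move=> _ _ /asboolP[a [a' [b [b' [Aa Ab b0 ->]]]]] /asboolP[c [c' [e [e' [Ac Ae e0 ->]]]]].
  apply/asboolP; exists (a * e - c * b), (a' * e' - c' * b'), (b * e), (b' * e').
  split; [by apply: AD; [exact: AM|apply: AN; exact: AM]|exact: AM|by rewrite mulf_neq0|].
  have b'0 := nz _ _ Ab b0; have e'0 := nz _ _ Ae e0.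
  rewrite -[LHS]/(a / b - c / e, a' / b' - c' / e').
  by congr (_, _); field; rewrite ?b0 ?e0 ?b'0 ?e'0.
- move=> _ _ /asboolP[a [a' [b [b' [Aa Ab b0 ->]]]]] /asboolP[c [c' [e [e' [Ac Ae e0 ->]]]]].
  apply/asboolP.
  have b'0 := nz _ _ Ab b0; have e'0 := nz _ _ Ae e0.
  have [c0|c0] := eqVneq c 0.
    have c'0 : c' = 0 by apply/eqP; rewrite -(A0 Ac) c0.
    exists (a * c), (a' * c'), b, b'; split=> //; first exact: AM.
    rewrite c0 c'0 !mul0r !mulr0 !mul0r.
    have -> : ((0, 0) : M * N)^-1 = 0.
      by rewrite invr_out //; apply/negP => /unitrP[[u v] /= [] [/eqP]]; rewrite mulr0 eq_sym oner_eq0.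
    by rewrite mulr0.
  have c'0 := nz _ _ Ac c0.
  exists (a * e), (a' * e'), (b * c), (b' * c').
  split; [exact: AM|exact: AM|by rewrite mulf_neq0|].
  have -> : (c / e, c' / e')^-1 = (e / c, e' / c') :> M * N.
    apply: mulr1_eq.
    rewrite -[LHS]/(c / e * (e / c), c' / e' * (e' / c')) -[RHS]/(1, 1).
    by congr (_, _); field; rewrite ?c0 ?e0 ?c'0 ?e'0.
  rewrite -[LHS]/(a / b * (e / c), a' / b' * (e' / c')).
  by congr (_, _) => /=; field; rewrite ?b0 ?c0 ?b'0 ?c'0.
Qed.

HB.instance Definition _ := GRing.isDivringClosed.Build (M * N)%type fraction_graph fraction_graph_closed.

Definition graph_field := {z : (M * N)%type | fraction_graph z}.
HB.instance Definition _ := [isSub of graph_field for @sval _ _].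
HB.instance Definition _ := [Choice of graph_field by <:].
HB.instance Definition _ := [SubChoice_isSubComUnitRing of graph_field by <:].

Lemma graph_field_mem x y : A x y -> fraction_graph (x, y).
Proof. by move=> Axy; apply/asboolP; exists x, y, 1, 1; rewrite !divr1 oner_neq0. Qed.

Lemma graph_field_unit (z : graph_field) : z != 0 -> z \is a GRing.unit.
Proof.
case: z => z zG z0; apply/unitrPr.
have /asboolP[a [a' [b [b' [Aa Ab b0 zE]]]]] := zG.
have b'0 : b' != 0 by rewrite -(A0 Ab).
have a0 : a != 0.
  apply: contra z0 => /eqP a0.
  have a'0 : a' = 0 by apply/eqP; rewrite -(A0 Aa) a0.
  by apply/eqP/val_inj; rewrite /= zE a0 a'0 !mul0r.
have a'0 : a' != 0 by rewrite -(A0 Aa).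
have yG : fraction_graph (b / a, b' / a') by apply/asboolP; exists b, b', a, a'.
exists (exist _ (b / a, b' / a') yG : graph_field); apply/val_inj.
rewrite /= zE -[LHS]/(a / b * (b / a), a' / b' * (b' / a')) -[RHS]/(1, 1).
by congr (_, _); field; rewrite ?a0 ?b0 ?a'0 ?b'0.
Qed.

HB.instance Definition _ := GRing.ComUnitRing_isField.Build graph_field graph_field_unit.

Lemma graph_field_exists :
  exists (F : fieldType) (i : {rmorphism F -> M}) (j : {rmorphism F -> N}),
  (forall x y, A x y -> exists f, i f = x /\ j f = y) /\
  (forall f, exists a b, [/\ b != 0, f = a / b, A (i a) (j a) & A (i b) (j b)]).
Proof.
exists graph_field, (fst \o val : {rmorphism graph_field -> M}),
  (snd \o val : {rmorphism graph_field -> N}); split.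
  by move=> x y Axy; exists (exist _ (x, y) (graph_field_mem Axy)).
move=> f; have /asboolP[a [a' [b [b' [Aa Ab b0 zE]]]]] := valP f.
have b'0 : b' != 0 by rewrite -(A0 Ab).
exists (exist _ (a, a') (graph_field_mem Aa) : graph_field).
have bE : (exist _ (b, b') (graph_field_mem Ab) : graph_field) != 0.
  by apply: contra b0 => /eqP/(congr1 val)/(congr1 fst)/= ->.
exists (exist _ (b, b') (graph_field_mem Ab) : graph_field); split=> //.
apply: (mulIf bE); rewrite divfK //; apply/val_inj => /=.
rewrite zE -[LHS]/(a / b * b, a' / b' * b').
by congr (_, _); field; rewrite ?b0 ?b'0.
Qed.

End GraphField.

Lemma fder_div q (K : fieldType) (d : K -> K) (a b : K) :
  frobenius_derivation q d -> b != 0 ->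
  d (a / b) = (d a - (a / b) ^+ q * d b) / b ^+ q.
Proof.
move=> dP b0; have := dP.2 (a / b) b; rewrite divfK // => ->.
by rewrite addrAC subrr add0r mulrAC mulfV ?mul1r // expf_neq0.
Qed.

(** The constants of the field of fractions F of A are p-th powers: if a/b has
    derivative 0 it is z^p in M, so a b^(p-1) = (z b)^p; closure of A under p-th
    roots yields z b in A, hence z in F. *)
Lemma graph_amalgam p n (M N : fieldType) (dM : M -> M) (dN : N -> N)
    (A : M -> N -> Prop) :
  p \in [pchar M] -> frobenius_derivation (p ^ n) dM -> frobenius_derivation (p ^ n) dN ->
  A 1 1 -> (forall x y x' y', A x y -> A x' y' -> A (x + x') (y + y')) ->
  (forall x y, A x y -> A (- x) (- y)) ->
  (forall x y x' y', A x y -> A x' y' -> A (x * x') (y * y')) ->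
  (forall x y, A x y -> (x == 0) = (y == 0)) ->
  (forall x y, A x y -> A (dM x) (dN y)) ->
  (forall z y, A (z ^+ p) y -> exists z', A z z') ->
  (forall x, dM x = 0 -> exists z, x = z ^+ p) ->
  exists (K : fieldType) (dK : K -> K) (h : {rmorphism M -> K}) (g : {rmorphism N -> K}),
  [/\ frobenius_derivation (p ^ n) dK, forall x, dK (h x) = h (dM x),
      forall y, dK (g y) = g (dN y) & forall x y, A x y -> h x = g y].
Proof.
move=> charM dMP dNP A1_ AD AN AM A0 Ad Aroot strict.
have [F [i [j [memF fracF]]]] := graph_field_exists A1_ AD AN AM A0.
have dex f : exists g, i g = dM (i f) /\ j g = dN (j f).
  have [a [b [b0 -> Aa Ab]]] := fracF f.
  have [a1 [ia1 ja1]] := memF _ _ (Ad _ _ Aa).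
  have [b1 [ib1 jb1]] := memF _ _ (Ad _ _ Ab).
  exists ((a1 - (a / b) ^+ (p ^ n) * b1) / b ^+ (p ^ n)).
  rewrite !fmorph_div !(fder_div _ dMP, fder_div _ dNP) ?fmorph_eq0 //.
  by rewrite -ia1 -ja1 -ib1 -jb1 !(rmorphB, rmorphM, rmorphXn, fmorphV, fmorph_div).
have [dF dFE] := choice dex.
have dFP : frobenius_derivation (p ^ n) dF.
  split=> x y; apply: (fmorph_inj i); rewrite (dFE _).1.
    by rewrite !rmorphD !(dFE _).1 dMP.1.
  by rewrite rmorphD !rmorphM !rmorphXn !(dFE _).1 dMP.2.
have charF : p \in [pchar F] by rewrite -(fmorph_pchar i).
have strictF x : dF x = 0 -> exists y, x = y ^+ p.
  move=> dx0; have := (dFE x).1; rewrite dx0 rmorph0 => /esym/strict[z].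
  have [a [b [b0 -> Aa Ab]]] := fracF x; rewrite fmorph_div => abz.
  have p0 : (0 < p)%N by exact: prime_gt0 (pcharf_prime charM).
  have ib0 : i b != 0 by rewrite fmorph_eq0.
  have AX k : A (i b ^+ k) (j b ^+ k) by elim: k => [//|k IH]; rewrite !exprS; exact: AM.
  have [|z' Az] := Aroot (z * i b) (j a * j b ^+ p.-1).
    rewrite exprMn -abz -{1}(prednK p0) exprS mulrA divfK //; exact: AM.
  have [u [iu _]] := memF _ _ Az.
  exists (u / b); apply: (fmorph_inj i).
  by rewrite rmorphXn !fmorph_div iu abz mulfK.
have [K [dK [h [g [dKP hd gd hg]]]]] := differential_amalgam charF dFP dMP dNP
  (fun x => (dFE x).1) (fun x => (dFE x).2) strictF.
exists K, dK, h, g; split=> // x y /memF[f [<- <-]]; exact: hg.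
Qed.

Lemma embedding_rmorphism (K L : fieldType) (dK : K -> K) (dL : L -> L)
    (h : {rmorphism K -> L}) :
  (forall x, dL (h x) = h (dK x)) ->
  @embedding Ld (differential_structure dK) (differential_structure dL) h.
Proof.
move=> hd; split; first exact: fmorph_inj.
move=> [[]|] a /=; first exact: rmorph0.
- exact: rmorph1.
- exact: rmorphD.
- exact: rmorphN.
- exact: rmorphM.
- by rewrite hd.
Qed.

Section ModelCompanion.
Variables (p n : nat) (FrDCF : theory Ld).
Hypothesis comp : model_companion (FrDF p n) FrDCF.

(** N embeds into a model of the companion, which is then an elementary extension
    of M. *)
Lemma existentially_closed (M N : structure Ld) (h : M -> N) k
    (phi : formula Ld k.+1) (e : 'I_k -> M) :
  models M FrDCF -> models N (FrDF p n) -> embedding h -> quantifier_free phi ->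
  sat (Ex phi) (h \o e) -> sat (Ex phi) e.
Proof.
case: comp => mc emb _ MT NT hE qphi [x sx].
have [N' [g [N'T gE]]] := emb _ NT.
apply/(mc _ _ _ MT N'T (embedding_comp hE gE)); exists (g x).
move/(sat_embedding gE qphi): sx; by rewrite env_cons_comp compA.
Qed.

Fixpoint universal L k (phi : formula L k) : Prop :=
  match phi with
  | All _ a => universal a
  | Ex _ _ => False
  | psi => quantifier_free psi
  end.

Lemma sat_universal L (M N : structure L) (h : M -> N) : embedding h ->
  forall k (phi : formula L k), universal phi ->
  forall e : 'I_k -> M, sat phi (h \o e) -> sat phi e.
Proof.
move=> hE k; elim=> {k} [k|k t u|k a _ b _|k a _ b _|k a _ b _|k a IH|k a _] //= qa e.
- by move=> /(sat_embedding hE (phi := Eq t u)); exact.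
- by move=> /(sat_embedding hE (phi := And a b) qa).
- by move=> /(sat_embedding hE (phi := Or a b) qa).
- by move=> /(sat_embedding hE (phi := Imp a b) qa).
- by move=> He x; apply: IH => //; rewrite env_cons_comp.
Qed.

(** All axioms of differential fields but one are universal, and pass to M from a
    differential field containing it.  The remaining one, existence of inverses,
    passes to M by existential closedness. *)
Lemma companion_model (M : structure Ld) : models M FrDCF -> models M (FrDF p n).
Proof.
case: (comp) => _ _ emb MT; have [N [h [NT hE]]] := emb _ MT.
move=> phi Tphi; have := NT _ Tphi.
rewrite (env0_eq (@env0 N) (h \o @env0 M)).
case: Tphi; try by apply: (sat_universal hE).
move=> Ninv x nx0.
apply: (existentially_closed (phi := Eq (tmul x0 x1) tone) MT NT hE) => //.
rewrite env_cons_comp; apply: Ninv; rewrite -env_cons_comp.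
exact/(sat_embedding hE (phi := Neg (Eq x0 tzero))).
Qed.

(** Otherwise [adjoin_root_of_constant] gives a differential field that contains M
    and a p-th root of x; then M contains one as well. *)
Lemma companion_strict (M : structure Ld) (K : fieldType) (d : K -> K)
    (f : M -> K) (g : K -> M) :
  models M FrDCF -> p \in [pchar K] -> frobenius_derivation (p ^ n) d ->
  @embedding Ld M (differential_structure d) f -> cancel g f ->
  forall x, d x = 0 -> exists z, x = z ^+ p.
Proof.
move=> MT charK dP fE gK x dx; apply: contrapT => nz.
have nroot y : y ^+ p != x by apply/eqP => yx; apply: nz; exists y.
have [L [dL [h [y [dLP hd yx]]]]] := adjoin_root_of_constant charK dP dx nroot.
have charL : p \in [pchar L] by rewrite (fmorph_pchar h).
have hE := embedding_rmorphism hd.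
have LT := models_differential_structure charL dLP.
have [y0 sy0] : sat (Ex (Eq (texp x0 p) x1)) (env_cons (g x) (@env0 M)).
  apply: (existentially_closed MT LT (embedding_comp fE hE)) => //.
  exists y; cbn [sat]; rewrite eval_texp_field /=.
  by rewrite env_cons_comp !(env_cons0, env_consS) /= gK.
apply: nz; exists (f y0); rewrite -[LHS]gK.
have /(congr1 f) := sy0; rewrite (eval_embedding fE) eval_texp_field /=.
by rewrite !(env_cons0, env_consS) => ->.
Qed.

End ModelCompanion.


(** * Quantifier elimination *)

(** The ring A consists of the pairs of values of one term at c and at d.
    Agreement on equations makes it the graph of a bijection between subrings of
    M and N, and since lambda0 is a symbol of the language, the p-th roots in M of
    elements of A belong to A. *)
Lemma common_extension p n (FrDCF : theory Ld) k (M N : structure Ldl)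
    (c : 'I_k -> M) (d : 'I_k -> N) :
  prime p -> model_companion (FrDF p n) FrDCF ->
  models M (with_lambda0 p FrDCF) -> models N (with_lambda0 p FrDCF) -> qf_agree (fun=> True) c d ->
  exists (K : structure Ld) (h : M -> K) (g : N -> K),
    [/\ models K FrDCF, @embedding Ld (reduct M) K h, @embedding Ld (reduct N) K g
      & h \o c = g \o d].
Proof.
move=> p_pr comp MT NT agree.
have [MT' [LM _]] := lambda_structureP MT; have [NT' _] := lambda_structureP NT.
have [KM [dM [fM [gM [charM dMP fME gME [fMK gMK]]]]]] :=
  field_of_model p_pr (companion_model comp MT').
have [KN [dN [fN [gN [charN dNP fNE gNE [fNK gNK]]]]]] :=
  field_of_model p_pr (companion_model comp NT').
pose A (x : KM) (y : KN) := exists t : term Ldl k, x = fM (eval c t) /\ y = fN (eval d t).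
have A_symb (s : symb Ld) (t : 'I_(arity s) -> term Ldl k) :
    A (@interp Ld (differential_structure dM) s (fun l => fM (eval c (t l))))
      (@interp Ld (differential_structure dN) s (fun l => fN (eval d (t l)))).
  exists (@App Ldl k (Some s) t); split.
  - exact: esym (fME.2 s (fun l => eval c (t l))).
  - exact: esym (fNE.2 s (fun l => eval d (t l))).
have Aeq x y x' y' : A x y -> A x' y' -> x = x' <-> y = y'.
  move=> [t [-> ->]] [u [-> ->]]; have /= tu := agree (Eq t u) I I.
  by split=> [/(can_inj fMK)/tu ->|/(can_inj fNK)/tu ->].
have A0 : A 0 0 by have := A_symb (Some Zero) (@env0 _).
have [K [dK [h [g [dKP hd gd hg]]]]] : exists (K : fieldType) (dK : K -> K)
    (h : {rmorphism KM -> K}) (g : {rmorphism KN -> K}),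
  [/\ frobenius_derivation (p ^ n) dK, forall x, dK (h x) = h (dM x),
      forall y, dK (g y) = g (dN y) & forall x y, A x y -> h x = g y].
  apply: (graph_amalgam charM dMP dNP).
  - by have := A_symb (Some One) (@env0 _).
  - move=> x y x' y' [t [-> ->]] [u [-> ->]].
    by have := A_symb (Some Add) (args2 t u).
  - move=> x y [t [-> ->]]; by have := A_symb (Some Opp) (args1 t).
  - move=> x y x' y' [t [-> ->]] [u [-> ->]].
    by have := A_symb (Some Mul) (args2 t u).
  - move=> x y Axy; have [xy yx] := Aeq _ _ _ _ Axy A0.
    by apply/eqP/eqP.
  - move=> x y [t [-> ->]]; by have := A_symb None (args1 t).
  - move=> z y [t [zt _]]; exists (fN (eval d (tlambda t))), (tlambda t); split=> //.
    have powz : power_of p (M := reduct M) (gM z) = eval c t.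
      apply: (can_inj fMK); rewrite -zt /power_of (eval_embedding fME) eval_texp_field.
      by rewrite /= /args1 gMK.
    have -> : eval c (tlambda t) = lambda_of (eval c t) by [].
    by rewrite -powz LM gMK.
  - exact: (companion_strict comp MT' charM dMP fME gMK).
have charK : p \in [pchar K] by rewrite (fmorph_pchar h).
have [mc emb _] := comp.
have [K' [e [K'T eE]]] := emb _ (models_differential_structure charK dKP).
exists K', (e \o (h \o fM)), (e \o (g \o fN)); split=> //.
- exact: embedding_comp (embedding_comp fME (embedding_rmorphism hd)) eE.
- exact: embedding_comp (embedding_comp fNE (embedding_rmorphism gd)) eE.
apply/funext => l /=; congr e; apply: hg.
by exists (Var l).
Qed.

Local Close Scope ring_scope.

Theorem theorem2p4 (p n : nat) (FrDCF : theory Ld) :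
  prime p -> 1 <= n ->
  model_companion (FrDF p n) FrDCF ->
  eliminates_quantifiers (with_lambda0 p FrDCF).
Proof.
move=> p_pr _ comp k phi; apply: quantifier_elimination_test.
  by move=> M _; exists (@interp Ldl M (Some (Some Zero)) (@env0 _)).
move=> M N c d MT NT agree.
have [K [h [g [KT hE gE hg]]]] := common_extension p_pr comp MT NT agree.
have [MT' LM] := lambda_structureP MT; have [NT' LN] := lambda_structureP NT.
have [phi' phi'P] := definable_sat p phi.
have [complete _ _] := comp.
move=> /(phi'P M LM)/(complete _ _ _ MT' KT hE k phi' c); rewrite hg.
by move=> /(complete _ _ _ NT' KT gE k phi' d)/(phi'P N LN).
Qed.
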